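(* Let $\delta=(\pi,\lambda)$ be a self-induced completed interval exchange transformation over the alphabet $A_N$ and let $\varphi$ be the associated $\delta$-automorphism of $F_N$. Let $\Sigma_\delta$ be the $\delta$-subshift and $\Sigma_\varphi$ the attracting subshift of $\varphi$. Then $\Sigma_\delta=\Sigma_\varphi$.
   Context: Free group. $F_N$ ($N\ge2$) is the free group with basis $A_N=\{a_0,\dots,a_{N-1}\}$, viewed as reduced words in $A_N\cup A_N^{-1}$; $\partial F_N$ is its Gromov boundary (infinite reduced words $V=V_0V_1\dots$), and $\partial^2F_N=(\partial F_N\times\partial F_N)\setminus\Delta$ with $\Delta$ the diagonal. The shift is $S(X,Y)=(Y_0^{-1}X,Y_0^{-1}Y)$, $Y_0$ the first letter of $Y$. An automorphism $\varphi$ is $A_N$-positive if all letters of $\varphi(a)$ are in $A_N$ for every $a\in A_N$; an $A_N$-positive automorphism is primitive if for some $k\ge1$ every letter of $A_N$ occurs in $\varphi^k(a)$ for every $a\in A_N$. Attracting subshift. For $\varphi$ $A_N$-positive primitive, choose $a\in A_N$ and $k\ge1$ with $\varphi^k(a)=pas$, where $p,s$ are nonempty words with letters in $A_N$. Put $X=\lim_n p^{-1}\varphi^k(p^{-1})\cdots\varphi^{nk}(p^{-1})$ and $Y=\lim_n as\varphi^k(s)\cdots\varphi^{nk}(s)$. Then $\Sigma_\varphi=\overline{\{S^n(X,Y):n\in\mathbb Z\}}\subset\partial^2F_N$; it is independent of the choices of $a,k$. Completed interval exchange transformation (CIET). Given a pair $\pi=(\pi_0,\pi_1)$ of bijections $A_N\to\{0,\dots,N-1\}$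 and a vector $\lambda=(\lambda_a)_{a\in A_N}$ of positive reals, $|\lambda|=\sum_a\lambda_a$, let $\Lambda_i(a)=\sum_{\pi_i(b)<\pi_i(a)}\lambda_b$ ($i=0,1$). The CIET $\delta=(\pi,\lambda)$ is the system of partial isometries $\delta_a:[\Lambda_0(a),\Lambda_0(a)+\lambda_a]\to[\Lambda_1(a),\Lambda_1(a)+\lambda_a]$, $x\mapsto x-\Lambda_0(a)+\Lambda_1(a)$, $a\in A_N$; put $\delta_{a^{-1}}=\delta_a^{-1}$. With $D(\cdot)$ denoting domain, for $x\in[0,|\lambda|]$ let $\Sigma_\delta(x)$ be the set of $(U,V)\in\partial^2F_N$ such that for all $n\ge 0$: $U_n^{-1}\in A_N$, $V_n\in A_N$, $x\in D(\delta_{U_n}\circ\dots\circ\delta_{U_0})$ and $x\in D(\delta_{V_n}\circ\dots\circ\delta_{V_0})$. The $\delta$-subshift is $\Sigma_\delta=\bigcup_{x\in[0,|\lambda|]}\Sigma_\delta(x)$. Rauzy induction. Let $\alpha_0=\pi_0^{-1}(N-1)$, $\alpha_1=\pi_1^{-1}(N-1)$ and assume $\lambda_{\alpha_0}\ne\lambda_{\alpha_1}$. Type 0 ($\lambda_{\alpha_0}>\lambda_{\alpha_1}$): $R(\delta)=(\pi',\lambda')$ with $\pi_0'=\pi_0$; $\pi_1'(a)=\pi_1(a)$ if $\pi_1(a)\le\pi_1(\alpha_0)$, $\pi_1'(\alpha_1)=\pi_1(\alpha_0)+1$, $\pi_1'(a)=\pi_1(a)+1$ if $\pi_1(\alpha_0)<\pi_1(a)<\pi_1(\alpha_1)$;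 $\lambda'_{\alpha_0}=\lambda_{\alpha_0}-\lambda_{\alpha_1}$ and $\lambda'_a=\lambda_a$ for $a\neq\alpha_0$. The associated Dehn twist is $\sigma:\alpha_1\mapsto\alpha_1\alpha_0$, $a\mapsto a$ for $a\ne\alpha_1$. Type 1 ($\lambda_{\alpha_0}<\lambda_{\alpha_1}$): $\pi_1'=\pi_1$; $\pi_0'(a)=\pi_0(a)$ if $\pi_0(a)\le\pi_0(\alpha_1)$, $\pi_0'(\alpha_0)=\pi_0(\alpha_1)+1$, $\pi_0'(a)=\pi_0(a)+1$ if $\pi_0(\alpha_1)<\pi_0(a)<\pi_0(\alpha_0)$; $\lambda'_{\alpha_1}=\lambda_{\alpha_1}-\lambda_{\alpha_0}$ and $\lambda'_a=\lambda_a$ for $a\ne\alpha_1$. The associated Dehn twist is $\sigma:\alpha_0\mapsto\alpha_1\alpha_0$, $a\mapsto a$ for $a\ne\alpha_0$. Self-induced CIET. $\delta=(\pi,\lambda)$ is self-induced if for some $n\ge1$, $R^n(\delta)$ is defined and equals $(\pi,\eta\lambda)$ for some real $\eta>0$. Taking the smallest such $n$ and letting $\sigma_i$ be the Dehn twist associated with the induction step from $R^i(\delta)$ to $R^{i+1}(\delta)$, the $\delta$-automorphism is $\varphi=\sigma_0\circ\dots\circ\sigma_{n-1}$. It is known (Yoccoz) that $\varphi$ is then $A_N$-positive and primitive, so that $\Sigma_\varphi$ is defined. *)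

(* Defs.v *)
From HB Require Import structures.
From mathcomp Require Import all_boot all_order all_algebra all_fingroup.
From mathcomp Require Import all_classical all_reals all_analysis.

Set Implicit Arguments.
Unset Strict Implicit.
Unset Printing Implicit Defensive.

Import Order.TTheory GRing.Theory Num.Theory.

Local Open Scope group_scope.
Local Open Scope classical_set_scope.
Local Open Scope ring_scope.
Local Open Scope group_scope.
Local Open Scope nat_scope.

(* The basis A_N = {a_0, ..., a_(N-1)} is 'I_N; the letter (a, true) is a and  *)
(* (a, false) is a^-1.                                                        *)
Definition letter (N : nat) : Type := ('I_N * bool)%type.
HB.instance Definition _ N := Finite.on (letter N).

Definition inv_letter N (x : letter N) : letter N := (x.1, ~~ x.2).

Lemma inv_letterK N : involutive (@inv_letter N).
Proof. by case=> a b; rewrite /inv_letter /= negbK. Qed.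

Section FreeGroup.
Variable N : nat.
Implicit Types (x y : letter N) (w : seq (letter N)).

Definition reduced w := sorted (fun x y => y != inv_letter x) w.

Record free_group := FreeGroup { word :> seq (letter N); _ : reduced word }.

HB.instance Definition _ := [isSub for word].
HB.instance Definition _ := [Choice of free_group by <:].

Lemma wordP (u : free_group) : reduced (word u). Proof. by case: u. Qed.

Lemma word_inj : injective word. Proof. exact: val_inj. Qed.

Definition push x w :=
  if w is y :: w' then if y == inv_letter x then w' else x :: w else [:: x].

Definition reduce w := foldr push [::] w.

Lemma push_reduced x w : reduced w -> reduced (push x w).
Proof.
case: w => // y w; rewrite /push; case: ifPn => [_|yx] rw.
  exact: path_sorted rw.
by rewrite /reduced /= yx.
Qed.

Lemma foldr_push_reduced w w' : reduced w' -> reduced (foldr push w' w).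
Proof. by move=> rw'; elim: w => //= x w /(push_reduced x). Qed.

Lemma reduce_reduced w : reduced (reduce w).
Proof. exact: foldr_push_reduced. Qed.

Lemma reduce_id w : reduced w -> reduce w = w.
Proof.
elim: w => //= x w IH rw; rewrite IH; last exact: path_sorted rw.
by case: w rw {IH} => //= y w /andP[/negPf ->].
Qed.

Lemma pushK x w : reduced w -> push (inv_letter x) (push x w) = w.
Proof.
case: w => [|y w] rw; first by rewrite /= inv_letterK eqxx.
rewrite [push x _]/=; case: eqP => [yx|_]; last first.
  by rewrite /= inv_letterK eqxx.
by subst y; case: w rw => //= z w /andP[/negPf -> _].
Qed.

Lemma pushVK x w : reduced w -> push x (push (inv_letter x) w) = w.
Proof. by move=> rw; rewrite -[X in push X]inv_letterK pushK. Qed.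

Lemma foldr_push w w' v : reduced v ->
  foldr push v (foldr push w' w) = foldr push (foldr push v w') w.
Proof.
move=> rv; elim: w => //= x w <-; move: (foldr push w' w) => [|y t] //=.
case: eqP => //= ->; rewrite pushVK //; exact: foldr_push_reduced.
Qed.

Definition inv_word w := rev (map (@inv_letter N) w).

Lemma inv_wordK : involutive inv_word.
Proof.
move=> w; rewrite /inv_word map_rev revK -map_comp.
by rewrite (eq_map (g := id)) ?map_id //; exact: inv_letterK.
Qed.

Lemma inv_word_reduced w : reduced w -> reduced (inv_word w).
Proof.
rewrite /reduced /inv_word rev_sorted sorted_map; apply: sub_sorted => x y /=.
by apply: contra => /eqP; rewrite inv_letterK => <-.
Qed.

Lemma foldr_push_inv w v : reduced v -> foldr push (foldr push v w) (inv_word w) = v.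
Proof.
move=> rv; elim: w => //= x w IH.
rewrite /inv_word /= rev_cons -cats1 foldr_cat /= pushK //.
exact: foldr_push_reduced.
Qed.

Definition fg_one := @FreeGroup [::] isT.
Definition fg_mul (u v : free_group) := FreeGroup (reduce_reduced (u ++ v)).
Definition fg_inv (u : free_group) := FreeGroup (inv_word_reduced (wordP u)).

Lemma fg_mulE u v : word (fg_mul u v) = foldr push v u.
Proof. by rewrite /= /reduce foldr_cat -/(reduce v) reduce_id //; exact: wordP. Qed.

Lemma fg_mulA : associative fg_mul.
Proof.
by move=> u v t; apply: word_inj; rewrite !(fg_mulE, foldr_push) //; exact: wordP.
Qed.

Lemma fg_mul1 : left_id fg_one fg_mul.
Proof. by move=> u; apply: word_inj; rewrite fg_mulE. Qed.

Lemma fg_mulr1 : right_id fg_one fg_mul.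
Proof.
by move=> u; apply: word_inj; rewrite /= cats0 reduce_id //; exact: wordP.
Qed.

Lemma fg_mulV : left_inverse fg_one fg_inv fg_mul.
Proof.
move=> u; apply: word_inj; rewrite fg_mulE /=.
rewrite -{1}[word u]reduce_id; [exact: foldr_push_inv|exact: wordP].
Qed.

Lemma fg_mulrV : right_inverse fg_one fg_inv fg_mul.
Proof.
move=> u; suff uVV : fg_inv (fg_inv u) = u by rewrite -{1}uVV fg_mulV.
by apply: word_inj; rewrite /= inv_wordK.
Qed.

HB.instance Definition _ :=
  isGroup.Build free_group fg_mulA fg_mul1 fg_mulr1 fg_mulV fg_mulrV.

Definition gen (a : 'I_N) : free_group := @FreeGroup [:: (a, true)] isT.

Definition positive_word (u : free_group) := all (fun x : letter N => x.2) u.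

End FreeGroup.

Section FreeExtension.
Variables (N : nat) (f : 'I_N -> free_group N).

(* The endomorphism of F_N with a |-> f a.                                    *)
Definition fg_ext (u : free_group N) : free_group N :=
  (\prod_(x <- word u) (if x.2 then f x.1 else (f x.1)^-1))%g.

Lemma fg_extM : {morph fg_ext : u v / (u * v)%g >-> (u * v)%g}.
Proof.
move=> u v; pose g (x : letter N) := if x.2 then f x.1 else (f x.1)^-1%g.
rewrite /fg_ext [word (u * v)%g]fg_mulE; elim: (word u) => [|x w IH] /=.
  by rewrite big_nil mul1g.
rewrite big_cons -mulgA -IH; move: (foldr _ _ w) => [|y t] /=.
  by rewrite big_cons.
case: eqP => [->|_]; last by rewrite big_cons.
rewrite big_cons /=; case: x => a [] /=.
  by rewrite mulVKg.
by rewrite mulKg.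
Qed.

Lemma fg_ext1 : fg_ext 1%g = 1%g. Proof. by rewrite /fg_ext big_nil. Qed.

HB.instance Definition _ :=
  isUMagmaMorphism.Build (free_group N) (free_group N) fg_ext (fg_ext1, fg_extM).

Lemma fg_extV u : fg_ext u^-1%g = (fg_ext u)^-1%g.
Proof. exact: (gmulfV fg_ext). Qed.

Lemma fg_ext_gen a : fg_ext (gen a) = f a.
Proof. by rewrite /fg_ext big_seq1. Qed.

End FreeExtension.

Lemma fg_ext_can N (f g : 'I_N -> free_group N) :
  (forall a, fg_ext f (g a) = gen a) -> cancel (fg_ext g) (fg_ext f).
Proof.
move=> fg [w]; elim: w => [|x w IH] rw.
  by have -> : FreeGroup rw = 1%g; [exact: word_inj|rewrite !fg_ext1].
have rw' : reduced w by exact: path_sorted rw.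
set y := if x.2 then gen x.1 else (gen x.1)^-1%g.
have -> : FreeGroup rw = (y * FreeGroup rw')%g.
  apply: word_inj; rewrite /y; case: x rw {y} => a b rw.
  rewrite [RHS]fg_mulE -[LHS](reduce_id rw) /= -{2}[w](reduce_id rw').
  by case: b {rw}.
rewrite !fg_extM IH; congr (_ * _)%g; rewrite /y.
by case: x {rw y} => a [] /=; rewrite ?fg_extV fg_ext_gen fg.
Qed.

Record automorphism (N : nat) := Automorphism {
  aut_fun :> free_group N -> free_group N;
  aut_morph : {morph aut_fun : u v / (u * v)%g >-> (u * v)%g};
  aut_bij : bijective aut_fun
}.

Section Automorphisms.
Variable N : nat.

Definition aut_id : automorphism N :=
  @Automorphism N id (fun _ _ => erefl) (inv_bij (fun _ => erefl)).

Lemma aut_comp_morph (phi psi : automorphism N) :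
  {morph phi \o psi : u v / (u * v)%g >-> (u * v)%g}.
Proof. by move=> u v /=; rewrite !aut_morph. Qed.

Definition aut_comp (phi psi : automorphism N) : automorphism N :=
  Automorphism (aut_comp_morph phi psi) (bij_comp (aut_bij phi) (aut_bij psi)).

(* dehn_r a c : a |-> a c and dehn_l a c : a |-> c a, other letters fixed.    *)
Definition dehn_r_fun (a c : 'I_N) :=
  fg_ext (fun b => if b == a then gen a * gen c else gen b)%g.
Definition dehn_l_fun (a c : 'I_N) :=
  fg_ext (fun b => if b == a then gen c * gen a else gen b)%g.

Lemma dehn_r_bij (a c : 'I_N) : a != c -> bijective (dehn_r_fun a c).
Proof.
move=> ac; have ca : c == a = false by rewrite eq_sym; exact: negbTE.
exists (fg_ext (fun b => if b == a then gen a * (gen c)^-1 else gen b))%g;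
  apply: fg_ext_can => b; case: eqP => [->|/eqP/negbTE ba];
  rewrite ?fg_extM ?fg_extV !fg_ext_gen ?eqxx ?ca ?ba //.
- by rewrite mulgVK.
- by rewrite mulgK.
Qed.

Lemma dehn_l_bij (a c : 'I_N) : a != c -> bijective (dehn_l_fun a c).
Proof.
move=> ac; have ca : c == a = false by rewrite eq_sym; exact: negbTE.
exists (fg_ext (fun b => if b == a then (gen c)^-1 * gen a else gen b))%g;
  apply: fg_ext_can => b; case: eqP => [->|/eqP/negbTE ba];
  rewrite ?fg_extM ?fg_extV !fg_ext_gen ?eqxx ?ca ?ba //.
- by rewrite mulVKg.
- by rewrite mulKg.
Qed.

Definition dehn_r (a c : 'I_N) (ac : a != c) : automorphism N :=
  Automorphism (fg_extM _) (dehn_r_bij ac).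
Definition dehn_l (a c : 'I_N) (ac : a != c) : automorphism N :=
  Automorphism (fg_extM _) (dehn_l_bij ac).

End Automorphisms.

Section Boundary.
Variable N : nat.

Record boundary := Boundary {
  ray :> nat -> letter N;
  rayP : forall i, ray i.+1 != inv_letter (ray i)
}.

HB.instance Definition _ := gen_eqMixin boundary.
HB.instance Definition _ := gen_choiceMixin boundary.
HB.instance Definition _ := Topological.copy boundary
  (initial_topology (ray : boundary -> {ptws nat -> discrete_topology (letter N)})).

(* Left multiplication of an infinite reduced word by one letter.             *)
Definition lact_ray (x : letter N) (V : nat -> letter N) : nat -> letter N :=
  if V 0 == inv_letter x then fun i => V i.+1
  else fun i => if i is j.+1 then V j else x.

Lemma lact_rayP x (V : boundary) i :
  lact_ray x V i.+1 != inv_letter (lact_ray x V i).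
Proof.
rewrite /lact_ray; case: ifPn => [_|V0]; first exact: rayP.
by case: i => [|i] //; exact: rayP.
Qed.

Definition lact x (V : boundary) : boundary := Boundary (lact_rayP x V).

Definition boundary2 : set (boundary * boundary) := [set P | P.1 <> P.2].

Definition shift2 (P : boundary * boundary) : boundary * boundary :=
  let x := inv_letter (P.2 0) in (lact x P.1, lact x P.2).

(* The inverse of the shift on the pairs (X, Y) with X_0 <> Y_0, a set        *)
(* preserved by the shift and on which it is bijective.                       *)
Definition unshift2 (P : boundary * boundary) : boundary * boundary :=
  let x := inv_letter (P.1 0) in (lact x P.1, lact x P.2).

Definition shift2z (n : int) : boundary * boundary -> boundary * boundary :=
  match n with
  | Posz m => iter m shift2
  | Negz m => iter m.+1 unshift2
  end.

(* Convergence, in F_N together with its boundary, of group elements to a     *)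
(* boundary point.                                                            *)
Definition cvg_boundary (w : nat -> free_group N) (V : boundary) : Prop :=
  forall m, \forall i \near \oo, take m (word (w i)) = mkseq V m.

End Boundary.

Section AttractingSubshift.
Variables (N : nat) (phi : automorphism N).

Definition positive_aut : Prop := forall a, positive_word (phi (gen a)).

Definition primitive_aut : Prop :=
  exists2 k, 0 < k & forall a b, (b, true) \in word (iter k phi (gen a)).

(* The data chosen in the construction of the attracting subshift of a        *)
(* positive primitive automorphism.                                           *)
Definition attracting_choice (a : 'I_N) (k : nat) (p s : free_group N) : Prop :=
  [/\ positive_aut, primitive_aut, 0 < k &
      [/\ p <> 1%g, s <> 1%g, positive_word p, positive_word s &
          iter k phi (gen a) = (p * gen a * s)%g]].

Definition attracting_point (a : 'I_N) (k : nat) (p s : free_group N)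
    (P : boundary N * boundary N) : Prop :=
  cvg_boundary (fun n => \prod_(0 <= i < n.+1) iter (i * k)%N phi p^-1)%g P.1 /\
  cvg_boundary (fun n => gen a * \prod_(0 <= i < n.+1) iter (i * k)%N phi s)%g P.2.

Definition attracting_subshift (a : 'I_N) (k : nat) (p s : free_group N) :
    set (boundary N * boundary N) :=
  boundary2 (N:=N) `&`
  closure [set Q | exists P n, attracting_point a k p s P /\ Q = shift2z n P].

End AttractingSubshift.

(* For a CIET over A_N, N = n + 2, the bijections pi_0 and pi_1 from A_N to   *)
(* {0, ..., N-1} are permutations of 'I_N.                                    *)
Record ciet (R : realType) (n : nat) := Ciet {
  pi0 : {perm 'I_n.+2};
  pi1 : {perm 'I_n.+2};
  len : 'I_n.+2 -> R;
  len_gt0 : forall a, (0 < len a)%R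
}.

Section Ciet.
Variables (R : realType) (n : nat).
Implicit Types (d : ciet R n) (x : letter n.+2) (t : R).

Definition offset (pi : {perm 'I_n.+2}) (l : 'I_n.+2 -> R) (a : 'I_n.+2) : R :=
  (\sum_(b | (pi b < pi a)%N) l b)%R.

Definition total_len d : R := (\sum_a len d a)%R.

Definition piso d x t : option R :=
  let: (a, b) := x in
  let L0 := offset (pi0 d) (len d) a in
  let L1 := offset (pi1 d) (len d) a in
  if b then
    if (L0 <= t <= L0 + len d a)%R then Some (t - L0 + L1)%R else None
  else
    if (L1 <= t <= L1 + len d a)%R then Some (t - L1 + L0)%R else None.

(* The composite of the partial isometries of the letters of w, the first     *)
(* letter being applied first.                                                *)
Definition piso_word d (w : seq (letter n.+2)) t : option R :=
  foldl (fun o x => obind (piso d x) o) (Some t) w.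

Definition ciet_subshift_at d t : set (boundary n.+2 * boundary n.+2) :=
  [set P | boundary2 P /\ forall m,
    [/\ ~~ (P.1 m).2, (P.2 m).2,
        isSome (piso_word d (mkseq P.1 m.+1) t) &
        isSome (piso_word d (mkseq P.2 m.+1) t)]].

Definition ciet_subshift d : set (boundary n.+2 * boundary n.+2) :=
  \bigcup_(t in [set t | (0 <= t <= total_len d)%R]) ciet_subshift_at d t.

End Ciet.

Section Rauzy.
Variables (R : realType) (n : nat).
Local Notation A := 'I_n.+2.

(* Rauzy induction composes one of the bijections with the map that moves the *)
(* last position N-1 to k+1 and j to j+1 for k < j < N-1.                     *)
Definition slide_fun (k j : A) : A :=
  if j <= k then j else if j == ord_max then inord k.+1 else inord j.+1.

Lemma slide_inj (k : A) : injective (slide_fun k).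
Proof.
have lt_max (j : A) : j != ord_max -> j.+1 < n.+2.
  move=> jm; rewrite ltnS ltn_neqAle -ltnS ltn_ord andbT.
  by apply: contra jm => /eqP jm; apply/eqP/val_inj.
have kS (j : A) : k < j -> k.+1 < n.+2 by move=> kj; exact: leq_ltn_trans kj _.
move=> i j /(congr1 val); rewrite /slide_fun.
case: (leqP i k) => ik; case: (leqP j k) => jk /=.
- exact: val_inj.
- case: eqP => [_|/eqP /lt_max jS]; rewrite /= inordK //; last first.
  + by move=> ij; move: ik; rewrite ij ltnNge (ltnW jk).
  + exact: kS jk.
  by move=> ij; move: ik; rewrite ij ltnn.
- case: eqP => [_|/eqP /lt_max iS]; rewrite /= inordK //; last first.
  + by move=> ij; move: jk; rewrite -ij ltnNge (ltnW ik).
  + exact: kS ik.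
  by move=> ij; move: jk; rewrite -ij ltnn.
- case: eqP => [->|/eqP /lt_max iS]; case: eqP => [->|/eqP /lt_max jS] //=;
    rewrite ?inordK ?(kS _ ik) ?(kS _ jk) //; case=> ij.
  + by move: jk; rewrite ij ltnn.
  + by move: ik; rewrite ij ltnn.
  + exact: val_inj.
Qed.

Definition slide (k : A) : {perm A} := perm (@slide_inj k).

(* The length vector with l a replaced by l a - l b.                          *)
Definition shorten (l : A -> R) (a b : A) : A -> R :=
  fun c => if c == a then (l a - l b)%R else l c.

Lemma shorten_gt0 (l : A -> R) (a b : A) :
  (forall c, 0 < l c)%R -> (l b < l a)%R -> forall c, (0 < shorten l a b c)%R.
Proof.
by move=> l0 ba c; rewrite /shorten; case: eqP => // _; rewrite subr_gt0.
Qed.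

Definition last0 (d : ciet R n) : A := ((pi0 d)^-1)%g ord_max.
Definition last1 (d : ciet R n) : A := ((pi1 d)^-1)%g ord_max.

Section Step.
Variable d : ciet R n.

Section Type0.
Hypothesis h : (len d (last1 d) < len d (last0 d))%R.

Definition rauzy0 : ciet R n :=
  Ciet (pi0 d) (pi1 d * slide (pi1 d (last0 d)))%g
    (shorten_gt0 (@len_gt0 _ _ d) h).

Lemma last10_neq : last1 d != last0 d.
Proof. by apply: contraTneq h => ->; rewrite ltxx. Qed.

Definition twist0 : automorphism n.+2 := dehn_r last10_neq.

End Type0.

Section Type1.
Hypothesis h : (len d (last0 d) < len d (last1 d))%R.

Definition rauzy1 : ciet R n :=
  Ciet (pi0 d * slide (pi0 d (last1 d)))%g (pi1 d)
    (shorten_gt0 (@len_gt0 _ _ d) h).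

Lemma last01_neq : last0 d != last1 d.
Proof. by apply: contraTneq h => ->; rewrite ltxx. Qed.

Definition twist1 : automorphism n.+2 := dehn_l last01_neq.

End Type1.

Definition rauzy_step : option (ciet R n * automorphism n.+2) :=
  match decP (@idP (len d (last1 d) < len d (last0 d))%R),
        decP (@idP (len d (last0 d) < len d (last1 d))%R) with
  | left h, _ => Some (rauzy0 h, twist0 h)
  | _, left h => Some (rauzy1 h, twist1 h)
  | _, _ => None
  end.

Definition rauzy : option (ciet R n) := omap fst rauzy_step.

End Step.

Definition rauzy_iter (m : nat) (d : ciet R n) : option (ciet R n) :=
  iter m (obind rauzy) (Some d).

Definition self_similar (d : ciet R n) (m : nat) : Prop :=
  exists d', [/\ rauzy_iter m d = Some d', pi0 d' = pi0 d, pi1 d' = pi1 d &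
    exists2 eta : R, (0 < eta)%R & forall a, len d' a = (eta * len d a)%R].

Definition self_induced (d : ciet R n) : Prop :=
  exists2 m, 0 < m & self_similar d m.

(* sigma_0 \o ... \o sigma_(m-1), sigma_i being the Dehn twist of the step    *)
(* from R^i(d) to R^(i+1)(d).                                                 *)
Fixpoint twists (m : nat) (d : ciet R n) : automorphism n.+2 :=
  if m is m'.+1 then
    if rauzy_step d is Some (d', sigma) then aut_comp sigma (twists m' d')
    else aut_id n.+2
  else aut_id n.+2.

Definition delta_automorphism (d : ciet R n) (phi : automorphism n.+2) : Prop :=
  exists m, [/\ 0 < m, self_similar d m,
    forall m', 0 < m' < m -> ~ self_similar d m' & phi = twists m d].

End Rauzy.

(* Main.v *)
Require Import Defs.
From mathcomp Require Import all_boot all_order all_algebra all_fingroup.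
From mathcomp Require Import all_classical all_reals all_analysis.
From mathcomp Require Import zify lra.

(* Positive pairs are bi-infinite words, and both subshifts consist of the     *)
(* words all of whose finite factors lie in a language: for the CIET, the      *)
(* words along which some point can be moved (a nested intersection of compact *)
(* intervals recovers the base point of an infinite word), and for the         *)
(* automorphism, the factors of the words phi^i(a).  So it is enough that the  *)
(* two languages agree.                                                        *)
(*   One step of Rauzy induction with twist sigma maps trajectories of R(d) to *)
(* trajectories of d by applying sigma, and every trajectory word of d is a    *)
(* factor of sigma(u) for a trajectory word u of R(d).  Hence the phi^i(a) are *)
(* trajectory words of d; conversely, after many periods of the induction, a   *)
(* trajectory word is a factor of phi^j(b c) for a transition b c of d.  If    *)
(* the transition takes place at a point t > 0, then t eventually leaves the   *)
(* domain eta^i [0, |lambda|] of the induced CIET, so b c must be interior to  *)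
(* some phi^i(a); a transition at t = 0 also takes place at nearby t > 0.      *)

Set Implicit Arguments.
Unset Strict Implicit.
Unset Printing Implicit Defensive.

Import Order.TTheory GRing.Theory Num.Theory.
Local Open Scope nat_scope.

(** The equality reduces to one statement on finite words, [admissible_factor]: the words followed
    by some point under [d] are exactly the factors of the words phi^i(a). [ciet_subshiftP] and
    [attracting_subshiftP] express membership in either subshift by the central windows of a
    positive pair.

    What one induction step preserves is collected in [renormalizes]: trajectories can be
    substituted and, up to factors, desubstituted; a transition at t either comes from a transition
    at the same t or is absorbed into the image of one letter. This is stable under composition and
    time reversal, so only a type 0 step has to be computed.

    Self-similarity then gives contraction ([ratio_lt1]), recurrence of every letter as winner
    ([winner_recurrent]), hence primitivity ([self_similar_primitive]) and images of unbounded
    length. A given word is thus covered by the image of one letter or of two adjacent ones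
    ([infix_subst_pair]), and [transition_factor] places the pair inside some phi^i(a). *)

(** * Substitutions on finite words *)

Section Substitutions.
Variable T : eqType.
Implicit Types (f g : T -> seq T) (u v w : seq T).

Definition subst f u := flatten (map f u).

Lemma subst_cat f u v : subst f (u ++ v) = subst f u ++ subst f v.
Proof. by rewrite /subst map_cat flatten_cat. Qed.

Lemma subst_cons f a u : subst f (a :: u) = f a ++ subst f u.
Proof. by []. Qed.

Lemma subst1 f a : subst f [:: a] = f a.
Proof. by rewrite /subst /= cats0. Qed.

Lemma subst_comp f g u : subst (fun a => subst f (g a)) u = subst f (subst g u).
Proof. by elim: u => //= a u IH; rewrite !subst_cons subst_cat IH. Qed.

Lemma eq_subst f g : f =1 g -> subst f =1 subst g.
Proof. by move=> fg u; rewrite /subst (eq_map fg). Qed.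

Lemma subst_id u : subst (fun a => [:: a]) u = u.
Proof. by elim: u => //= a u IH; rewrite subst_cons IH. Qed.

Lemma iter_subst_cat f i u v :
  iter i (subst f) (u ++ v) = iter i (subst f) u ++ iter i (subst f) v.
Proof. by elim: i => //= i ->; rewrite subst_cat. Qed.

Lemma subst_rev f u : rev (subst f u) = subst (fun a => rev (f a)) (rev u).
Proof.
elim: u => //= a u IH.
by rewrite subst_cons rev_cat IH rev_cons -cats1 subst_cat subst1.
Qed.

Lemma infix_subst f u v : infix u v -> infix (subst f u) (subst f v).
Proof. by case/infixP=> p [s ->]; rewrite !subst_cat infix_infix. Qed.

Lemma infix_mem f a u : a \in u -> infix (f a) (subst f u).
Proof. by rewrite -infix1s -(subst1 f a) => /infix_subst; apply. Qed.

Lemma mem_subst f b u : (b \in subst f u) = has (fun a => b \in f a) u.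
Proof. by elim: u => //= a u IH; rewrite subst_cons mem_cat IH. Qed.

(** An occurrence of [u] starts within the image of some letter and is too short to go past the
    image of the next one. *)
Lemma infix_subst_pair f u w : 0 < size u -> (forall a, size u <= size (f a)) ->
  infix u (subst f w) ->
  (exists a, infix u (f a)) \/
  (exists a b, infix [:: a; b] w /\ infix u (subst f [:: a; b])).
Proof.
move=> u0 uf; elim: w => [|a w IH].
  by move=> /size_infix; rewrite /subst /= leqNgt u0.
rewrite subst_cons => /infixP[p [s E]].
case: (leqP (size (f a)) (size p)) => fp.
  have /IH[|[b [c [bcw ubc]]]] : infix u (subst f w).
  - have := congr1 (drop (size (f a))) E.
    rewrite drop_size_cat // drop_cat; case: ltnP => pf ->.
      exact: infix_infix.
    have -> : size (f a) = size p by apply/eqP; rewrite eqn_leq fp pf.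
    by rewrite subnn drop0 prefix_infix.
  - by left.
  by right; exists b, c; split=> //; exact: (infix_catl [:: a]).
case: w E {IH} => [|b w] E.
  by left; exists a; rewrite -(subst1 f a) subst_cons E infix_infix.
right; exists a, b; split; first exact: (prefixW (prefix_prefix [:: a; b] w)).
(* The occurrence starts inside [f a], so truncating after [f a ++ f b] keeps all of it. *)
have := congr1 (take (size (f a) + size (f b))) E.
rewrite subst_cons catA take_size_cat ?size_cat // catA take_cat.
have ub := uf b; rewrite size_cat; case: ltnP => [|_]; first by lia.
by rewrite -catA subst_cons subst1 => ->; rewrite infix_infix.
Qed.

End Substitutions.

(** * Positive words in the free group *)

Section PositiveWords.
Variable N : nat.
Implicit Types (u v : seq 'I_N) (phi psi : automorphism N).

Lemma pos_reduced u : reduced [seq (a, true) | a <- u].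
Proof.
rewrite /reduced sorted_map; case: u => //= a u.
by elim: u a => //= b u IH a; rewrite IH andbT; apply/eqP => -[].
Qed.

Definition pos u : free_group N := FreeGroup (pos_reduced u).

Lemma pos_cat u v : pos (u ++ v) = (pos u * pos v)%g.
Proof.
apply: word_inj; rewrite /= -map_cat reduce_id //; exact: pos_reduced.
Qed.

Lemma pos_cons a u : pos (a :: u) = (gen a * pos u)%g.
Proof. by rewrite -cat1s pos_cat; congr (_ * _)%g; exact: word_inj. Qed.

Lemma pos_nil : pos [::] = 1%g. Proof. exact: word_inj. Qed.

Lemma pos1 a : pos [:: a] = gen a. Proof. exact: word_inj. Qed.

Lemma pos_inj : injective pos.
Proof.
move=> u v /(congr1 (@word N)) /=; apply: inj_map; by move=> a b [].
Qed.

Lemma pos_neq1 u : 0 < size u -> pos u <> 1%g.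
Proof. by move=> u0; rewrite -pos_nil => /pos_inj uN; rewrite uN in u0. Qed.

Lemma positive_wordE (g : free_group N) :
  positive_word g -> g = pos (map fst (word g)).
Proof.
move=> pg; apply: word_inj => /=; move: pg; rewrite /positive_word.
by elim: (word g) => //= -[a []] //= w IH /IH <-.
Qed.

Lemma positive_pos u : positive_word (pos u).
Proof. by rewrite /positive_word /= all_map; exact/allP. Qed.

Lemma mem_pos a u : ((a, true) \in word (pos u)) = (a \in u).
Proof. by rewrite /= mem_map // => b c []. Qed.

Lemma aut1 phi : phi 1%g = 1%g.
Proof. by apply: (mulgI (phi 1%g)); rewrite -aut_morph !mulg1. Qed.

Lemma autV phi g : phi (g^-1)%g = ((phi g)^-1)%g.
Proof. by apply: (mulgI (phi g)); rewrite -aut_morph !mulgV aut1. Qed.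

(** Positive words multiply without cancellation, so this turns computations in the group into
    computations with substitutions. *)
Definition induces phi f := forall a, phi (gen a) = pos (f a).

Lemma induces_pos phi f u : induces phi f -> phi (pos u) = pos (subst f u).
Proof.
move=> phif; elim: u => [|a u IH]; first by rewrite /subst pos_nil aut1.
by rewrite pos_cons aut_morph IH phif -pos_cat.
Qed.

Lemma induces_iter phi f i u : induces phi f ->
  iter i phi (pos u) = pos (iter i (subst f) u).
Proof. by move=> phif; elim: i => //= i ->; rewrite (induces_pos _ phif). Qed.

Lemma iter_autV phi i g : iter i phi (g^-1)%g = ((iter i phi g)^-1)%g.
Proof. by elim: i => //= i ->; rewrite autV. Qed.

Lemma word_posV u : word ((pos u)^-1)%g = rev [seq (a, false) | a <- u].
Proof. by rewrite /= /inv_word -map_comp. Qed.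

End PositiveWords.

(** * Endpoints of the intervals *)

Section Offsets.
Variables (R : realType) (n : nat).
Implicit Types (p : {perm 'I_n.+2}) (l : 'I_n.+2 -> R) (a b : 'I_n.+2).
Local Open Scope ring_scope.

Lemma offset_ge0 p l a : (forall b, 0 < l b) -> 0 <= offset p l a.
Proof. by move=> l0; apply: sumr_ge0 => b _; exact: ltW. Qed.

Lemma offset_addE p l a : offset p l a + l a = \sum_(b | (p b <= p a)%N) l b.
Proof.
rewrite (bigD1 a) //= addrC; congr (_ + _); apply: eq_bigl => b.
by rewrite ltn_neqAle andbC (inj_eq val_inj) (inj_eq perm_inj).
Qed.

Lemma offset_lt p l a b : (forall c, 0 < l c) -> (p b < p a)%N ->
  offset p l b + l b <= offset p l a.
Proof.
move=> l0 ba; rewrite offset_addE /offset big_mkcond [leRHS]big_mkcond /=.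
apply: ler_sum => c _; case: (leqP (p c) (p b)) => cb.
  by rewrite (leq_ltn_trans cb ba).
by case: ifP => // _; exact: ltW.
Qed.

Lemma offset_max p l a : p a = ord_max -> offset p l a + l a = \sum_b l b.
Proof.
by move=> pa; rewrite offset_addE; apply: eq_bigl => b; rewrite pa -ltnS ltn_ord.
Qed.

Lemma offset_le_sum p l a : (forall c, 0 < l c) ->
  offset p l a + l a <= \sum_b l b.
Proof.
move=> l0; rewrite offset_addE big_mkcond /=; apply: ler_sum => c _.
by case: ifP => // _; exact: ltW.
Qed.

Lemma offsetZ p l l' (e : R) a : (forall b, l' b = e * l b) ->
  offset p l' a = e * offset p l a.
Proof. by move=> le; rewrite /offset mulr_sumr; apply: eq_bigr => b _. Qed.

Lemma sum_split2 (F : 'I_n.+2 -> R) a b : a != b ->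
  \sum_c F c = F a + (F b + \sum_(c | (c != a) && (c != b)) F c).
Proof. by move=> ab; rewrite (bigD1 a) // (bigD1 b) // eq_sym. Qed.

(** The bound on [k] keeps the argument of [inord] in range. *)
Lemma slideE (k j : 'I_n.+2) : (k < n.+1)%N ->
  slide k j = (if (j <= k)%N then nat_of_ord j
               else if j == ord_max then k.+1 else j.+1) :> nat.
Proof.
move=> kn; rewrite permE /slide_fun; case: ifP => // jk.
case: eqP => [_|jm]; rewrite inordK //; move: (ltn_ord j); rewrite ltnS leq_eqVlt.
by case/orP => // /eqP jn; case: jm; apply: val_inj.
Qed.

End Offsets.

(** * Trajectories and time reversal *)

Section Trajectories.
Variables (R : realType) (n : nat).
Implicit Types (d : ciet R n) (a b c : 'I_n.+2) (u v : seq 'I_n.+2) (x y z t : R).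
Local Open Scope ring_scope.

Definition dom_offset d a := offset (pi0 d) (len d) a.
Definition im_offset d a := offset (pi1 d) (len d) a.

(** The graph of a partial isometry: as a relation, it is reversed in time by exchanging [x] and
    [y]. *)
Definition move d a x y : Prop :=
  [/\ dom_offset d a <= x, x <= dom_offset d a + len d a &
      y = x - dom_offset d a + im_offset d a].

Fixpoint traj d x u y : Prop :=
  if u is a :: u' then exists2 z, move d a x z & traj d z u' y else x = y.

Lemma traj_cat d x u v y :
  traj d x (u ++ v) y <-> exists2 z, traj d x u z & traj d z v y.
Proof.
elim: u x => [|a u IH] x /=; first by split=> [?|[z -> //]]; exists x.
split=> [[z xz /IH[w zw wy]]|[w [z xz zw] wy]].
  by exists w => //; exists z.
by exists z => //; apply/IH; exists w.
Qed.

Lemma traj1 d x a y : traj d x [:: a] y <-> move d a x y.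
Proof. by split=> [[z xz <-]|xy]; last exists y. Qed.

Lemma traj_infix d x u v y : infix u v -> traj d x v y ->
  exists x' y', traj d x' u y'.
Proof.
move=> /infixP[p [s ->]] /traj_cat[x' _ /traj_cat[y' uy _]].
by exists x', y'.
Qed.

(** The inverse system; it exchanges the two types of induction step and reverses trajectories. *)
Definition flip d : ciet R n := Ciet (pi1 d) (pi0 d) (@len_gt0 _ _ d).

Lemma move_flip d a x y : move (flip d) a x y <-> move d a y x.
Proof.
rewrite /move /dom_offset /im_offset /=.
by split=> -[h1 h2 ->]; split; lra.
Qed.

Lemma traj_flip d x u y : traj (flip d) x (rev u) y <-> traj d y u x.
Proof.
elim: u y => [|a u IH] y; first by split=> ->.
rewrite rev_cons -cats1 traj_cat /=; split=> [[z xz /traj1 zy]|[z yz zx]].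
  by exists z; [exact/move_flip|exact/IH].
by exists z; [exact/IH|apply/traj1/move_flip].
Qed.

Lemma traj_exists d a : exists x y, traj d x [:: a] y.
Proof.
exists (dom_offset d a), (im_offset d a); apply/traj1.
have := len_gt0 d a; rewrite /move => ?; split; lra.
Qed.

Lemma move_dom d a x y : move d a x y -> 0 <= x <= total_len d.
Proof.
case=> h1 h2 _; apply/andP; split.
  by apply: le_trans h1; apply: offset_ge0; exact: len_gt0.
by apply: (le_trans h2); apply: offset_le_sum; exact: len_gt0.
Qed.

Lemma move_im d a x y : move d a x y -> 0 <= y <= total_len d.
Proof. by move/move_flip/move_dom. Qed.

(** The intermediate point [t] is kept so that it can be compared with the shrinking domains of the
    induced systems. *)
Definition transition d b c t := (exists x, move d b x t) /\ (exists y, move d c t y).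

Lemma transition_flip d b c t : transition (flip d) b c t <-> transition d c b t.
Proof.
by split=> -[[x h1] [y h2]]; split; [exists y|exists x|exists y|exists x];
  exact/move_flip.
Qed.

(** * A type 0 step of Rauzy induction *)

Section TypeZero.
Variables (d : ciet R n) (h : len d (last1 d) < len d (last0 d)).
Let a0 := last0 d.
Let a1 := last1 d.
Let d' := rauzy0 h.

Definition twist0_subst d b := if b == last1 d then [:: last1 d; last0 d] else [:: b].
Let g := twist0_subst d.

Let a10 : a1 != a0. Proof. exact: last10_neq h. Qed.
Let pi0a0 : pi0 d a0 = ord_max. Proof. exact: permKV. Qed.
Let pi1a1 : pi1 d a1 = ord_max. Proof. exact: permKV. Qed.
Let l0 : 0 < len d a0. Proof. exact: len_gt0. Qed.
Let l1 : 0 < len d a1. Proof. exact: len_gt0. Qed.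

Let lt_max (p : {perm 'I_n.+2}) b c : p c = ord_max -> b != c -> (p b < n.+1)%N.
Proof.
move=> pc bc; have := ltn_ord (p b); rewrite ltnS leq_eqVlt => /orP[|//].
by move/eqP=> pb; case/eqP: bc; apply: (@perm_inj _ p); rewrite pc; exact: val_inj.
Qed.

Let a1a0 : len d a1 < len d a0. Proof. exact: h. Qed.

(** Only the rightmost domain interval is shortened, so no left endpoint moves. *)
Lemma rauzy0_dom_offset b : dom_offset d' b = dom_offset d b.
Proof.
apply: eq_bigr => c cb; rewrite /= /Defs.shorten -/a0; have [ca|//] := eqVneq c a0.
by move: cb; rewrite ca /= pi0a0 ltnNge -ltnS ltn_ord.

Qed.

Let pi1E b : b != a1 ->
  pi1 d' b = (if (pi1 d b <= pi1 d a0)%N then nat_of_ord (pi1 d b)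
              else (pi1 d b).+1) :> nat.
Proof.
move=> ba; have a0k : (pi1 d a0 < n.+1)%N by apply: lt_max pi1a1 _; rewrite eq_sym.
rewrite permM slideE //; case: ifP => // _.
have [bm|//] := eqVneq (pi1 d b) ord_max; by have := lt_max pi1a1 ba; rewrite bm /= ltnn.
Qed.

Let pi1a1E : pi1 d' a1 = (pi1 d a0).+1 :> nat.
Proof.
have a0k : (pi1 d a0 < n.+1)%N by apply: lt_max pi1a1 _; rewrite eq_sym.
by rewrite permM slideE // pi1a1 eqxx leqNgt a0k.
Qed.

Let len' b : len d' b = if b == a0 then len d a0 - len d a1 else len d b.
Proof. by []. Qed.

(** To the right of [a0], the length lost by [a0] is given back by [a1], now inserted just after
    [a0]. *)
Lemma rauzy0_im_offset b : b != a1 -> im_offset d' b = im_offset d b.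
Proof.
move=> ba1; have a01 : a0 != a1 by rewrite eq_sym.
have bk := lt_max pi1a1 ba1.
rewrite /im_offset /offset big_mkcond [RHS]big_mkcond.
rewrite !(sum_split2 _ a10).
have -> : \sum_(c | (c != a1) && (c != a0))
    (if (pi1 d' c < pi1 d' b)%N then len d' c else 0) =
  \sum_(c | (c != a1) && (c != a0)) (if (pi1 d c < pi1 d b)%N then len d c else 0).
  apply: eq_bigr => c /andP[c1 c0]; rewrite len' (negbTE c0) !pi1E //.
  by congr (if _ then _ else _); case: ifP; case: ifP; lia.
rewrite !len' eqxx (negbTE a10) !addrA; congr (_ + _).
rewrite pi1a1E !pi1E // leqnn pi1a1.
rewrite [in X in _ = X + _]ltnNge (ltnW bk) /= add0r.
case: (leqP (pi1 d b) (pi1 d a0)) => ba; last by rewrite ltnS ba (ltnW _) // subrKC.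
by rewrite ltnNge leqW //= ltnNge ba add0r.
Qed.

Lemma rauzy0_im_offset1 :
  im_offset d' a1 = im_offset d a0 + len d a0 - len d a1.
Proof.
have a01 : a0 != a1 by rewrite eq_sym.
have a0k := lt_max pi1a1 a01.
have -> : im_offset d' a1 = im_offset d' a0 + len d' a0.
  rewrite /im_offset offset_addE /offset; apply: eq_bigl => c.
  have [->|c1] := eqVneq c a1; first by rewrite ltnn pi1a1E pi1E // leqnn ltnn.
  by rewrite pi1a1E !pi1E // leqnn; case: ifP; lia.
by rewrite rauzy0_im_offset // len' eqxx addrA.
Qed.

Let dom0 : dom_offset d a0 + len d a0 = total_len d.
Proof. exact: offset_max. Qed.

Let im1 : im_offset d a1 + len d a1 = total_len d.
Proof. exact: offset_max. Qed.

Let dom_lt b : b != a0 -> dom_offset d b + len d b <= dom_offset d a0.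
Proof.
by move=> ba; apply: offset_lt; [exact: len_gt0|rewrite pi0a0; exact: lt_max pi0a0 ba].
Qed.

Let im_lt b : b != a1 -> im_offset d b + len d b <= im_offset d a1.
Proof.
by move=> ba; apply: offset_lt; [exact: len_gt0|rewrite pi1a1; exact: lt_max pi1a1 ba].
Qed.

Ltac typezero_lra := move: l0 l1 a1a0 dom0 im1 => *; lra.

Let move_sub b x y : b != a1 -> move d' b x y -> move d b x y.
Proof.
move=> ba; rewrite /move rauzy0_dom_offset rauzy0_im_offset // len'.
by case: eqVneq => [->|_] -[h1 h2 h3]; split=> //; typezero_lra.
Qed.

Let move_other b x y : b != a1 -> b != a0 -> move d b x y -> move d' b x y.
Proof.
move=> b1 b0; rewrite /move rauzy0_dom_offset rauzy0_im_offset // len'.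
by rewrite (negbTE b0).
Qed.

Let move_a0 x y : move d a0 x y -> x <= total_len d - len d a1 -> move d' a0 x y.
Proof.
rewrite /move rauzy0_dom_offset rauzy0_im_offset 1?eq_sym // len' eqxx.
by case=> h1 h2 h3 h4; split=> //; typezero_lra.
Qed.

(** The domain does not shrink under this composition, because the image of [a1] is contained in the
    domain of [a0]. *)
Let move_a1 x y : move d' a1 x y <-> exists2 z, move d a1 x z & move d a0 z y.
Proof.
rewrite /move rauzy0_dom_offset rauzy0_im_offset1 len' (negbTE a10).
split=> [[h1 h2 h3]|[z [h1 h2 h3] [h4 h5 h6]]]; last by split; typezero_lra.
by exists (x - dom_offset d a1 + im_offset d a1); split; typezero_lra.
Qed.

Let move_after_a1 x y : move d a1 x y -> exists z, move d a0 y z.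
Proof.
by case=> h1 h2 h3; exists (y - dom_offset d a0 + im_offset d a0); split; typezero_lra.
Qed.

(** The image of [a1] lies strictly to the right of the domains of all letters other than [a0]. *)
Let after_a1 b x y z : move d a1 x y -> move d b y z -> b = a0.
Proof.
case=> h1 h2 h3 [h4 h5 _]; apply/eqP; apply: contraT => /dom_lt h6.
have : False by typezero_lra.
by [].
Qed.

Let im_low b x y : b != a1 -> move d b x y -> y <= total_len d - len d a1.
Proof. by move=> /im_lt h4 [h1 h2 h3]; typezero_lra. Qed.

Let dom_low b x y : b != a0 -> move d b x y -> x <= total_len d - len d a1.
Proof. by move=> /dom_lt h4 [h1 h2 h3]; typezero_lra. Qed.

Let before_high x : total_len d - len d a1 <= x -> x <= total_len d ->
  exists z, move d a1 z x.
Proof.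
by move=> h1 h2; exists (x - im_offset d a1 + dom_offset d a1); split; typezero_lra.
Qed.

Let move_high b x y : move d b x y -> total_len d - len d a1 <= x ->
  exists z, move d a1 z x.
Proof. by move=> /move_dom/andP[_ xt] ?; exact: before_high. Qed.

Let g1 : g a1 = [:: a1; a0]. Proof. by rewrite /g /twist0_subst eqxx. Qed.
Let gN b : b != a1 -> g b = [:: b].
Proof. by rewrite /g /twist0_subst => /negbTE ->. Qed.

Lemma rauzy0_traj x u y : traj d' x u y -> traj d x (subst g u) y.
Proof.
elim: u x => [//|b u IH] x [z xz /IH zy]; rewrite subst_cons.
apply/traj_cat; exists z => //; have [b1|b1] := eqVneq b a1.
  by move: xz; rewrite b1 g1 => /move_a1[w xw wz]; exists w => //; apply/traj1.
by rewrite gN //; apply/traj1; exact: move_sub.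
Qed.

(** From a point of the induced interval, a word is decoded greedily: [a1] must be followed by [a0],
    and the two form the image of [a1]; any other letter is its own image. Decoding [a1] consumes
    two letters, hence the bound [k]; [s] supplies the missing [a0] when [u] ends in [a1]. *)
Let desub_low k x u y : (size u <= k)%N -> x <= total_len d - len d a1 ->
  traj d x u y -> exists u' y' s, traj d' x u' y' /\ subst g u' = u ++ s.
Proof.
elim: k x u => [|k IH] x [|b u] //= uk xT.
- by exists [::], x, [::].
- by exists [::], x, [::].
case=> z xz zy; have [b1|b1] := eqVneq b a1; last first.
  have xz' : move d' b x z.
    have [b0|b0] := eqVneq b a0; last exact: move_other.
    by rewrite b0 in xz *; exact: move_a0.
  have [||u' [y' [s [zu' us]]]] := IH _ _ _ _ zy; [by []|exact: im_low xz|].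
  exists (b :: u'), y', s; split; first by exists z.
  by rewrite subst_cons gN // us.
subst b; case: u uk zy => [_ _|c u uk [w zw wy]].
  have [w zw] := move_after_a1 xz.
  exists [:: a1], w, [:: a0]; split; last by rewrite subst1 g1.
  by apply/traj1/move_a1; exists z.
have c0 := after_a1 xz zw; subst c.
have [||u' [y' [s [wu' us]]]] := IH _ _ _ _ wy.
- exact: ltnW.
- by apply: im_low zw; rewrite eq_sym.
exists (a1 :: u'), y', s; split; last by rewrite subst_cons g1 us.
by exists w => //; apply/move_a1; exists z.
Qed.

Lemma rauzy0_desubst x u y : traj d x u y ->
  exists x' u' y', traj d' x' u' y' /\ infix u (subst g u').
Proof.
move=> uxy; have [xT|xT] := leP x (total_len d - len d a1).
  have [u' [y' [s [h1 h2]]]] := desub_low (leqnn _) xT uxy.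
  by exists x, u', y'; rewrite h2 prefix_infix.
(* A point above the induced interval is in the image of [a1]; prepending [a1] gives a low starting
   point. *)
case: u uxy => [|b u] uxy; first by exists x, [::], x; split.
have [z xz _] := uxy; have [w wx] := move_high xz (ltW xT).
have wy : traj d w (a1 :: b :: u) y by exists x; [exact: wx|exact: uxy].
have [u' [y' [s [h1 h2]]]] := desub_low (leqnn _) (dom_low a10 wx) wy.
by exists w, u', y'; split=> //; rewrite h2 -(cat1s a1) -catA infix_infix.
Qed.

(** If [b] is [a1], then [c] is [a0] and the pair is the image of [a1]. Otherwise [t] lies in the
    induced interval, [c] begins its own image, and [b] ends its own image or, if it is [a0] applied
    above that interval, the image of [a1]. *)
Lemma rauzy0_transition b c t : transition d b c t ->
  (exists b' c', transition d' b' c' t /\ infix [:: b; c] (subst g [:: b'; c'])) \/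
  (exists e, infix [:: b; c] (g e)).
Proof.
case=> -[x bt] [y ct]; have [b1|b1] := eqVneq b a1.
  by right; exists a1; rewrite b1 in bt *; rewrite (after_a1 bt ct) g1 infix_refl.
have tT := im_low b1 bt; left.
have [ct' [r cr]] : (exists y', move d' c t y') /\ exists r, g c = c :: r.
  have [c1|c1] := eqVneq c a1.
    rewrite c1 in ct *; have [z yz] := move_after_a1 ct.
    by split; [exists z; apply/move_a1; exists y|exists [:: a0]].
  split; last by exists [::]; rewrite gN.
  exists y; have [c0|c0] := eqVneq c a0; last exact: move_other.
  by rewrite c0 in ct *; exact: move_a0.
have [b' [x' bt'] [r' br]] : exists2 b', (exists x', move d' b' x' t) &
    exists r', g b' = r' ++ [:: b].
  have [b0|b0] := eqVneq b a0; last first.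
    by exists b; [exists x; exact: move_other|exists [::]; rewrite gN].
  have [xT|xT] := leP x (total_len d - len d a1).
    by exists b; [exists x; rewrite b0 in bt *; exact: move_a0|exists [::]; rewrite gN].
  have [w wx] := move_high bt (ltW xT).
  exists a1; last by exists [:: a1]; rewrite g1 b0.
  by exists w; apply/move_a1; exists x; rewrite -?b0.
exists b', c; split; first by split; [exists x'|exact: ct'].
by rewrite subst_cons subst1 br cr -catA; exact: (infix_infix r' [:: b; c] r).
Qed.

End TypeZero.
End Trajectories.

(** * Renormalization along the induction *)

Section InductionSteps.
Variables (R : realType) (n : nat).
Implicit Types (d : ciet R n) (a b c : 'I_n.+2) (u v : seq 'I_n.+2) (x y z t : R).
Implicit Types (g : 'I_n.+2 -> seq 'I_n.+2).
Local Open Scope ring_scope.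

(** The last field makes the transition property composable: a pair inside [g e] stays inside the
    image of [e] under the composite. *)
Record renormalizes d d' g : Prop := Renormalizes {
  renormalizes_traj : forall x u y, traj d' x u y -> traj d x (subst g u) y;
  renormalizes_desubst : forall x u y, traj d x u y ->
    exists x' u' y', traj d' x' u' y' /\ infix u (subst g u');
  renormalizes_transition : forall b c t, transition d b c t ->
    (exists b' c', transition d' b' c' t /\ infix [:: b; c] (subst g [:: b'; c'])) \/
    (exists e, infix [:: b; c] (g e));
  renormalizes_mem : forall a, a \in g a
}.

Lemma renormalizes_id d : renormalizes d d (fun a => [:: a]).
Proof.
split=> [x u y|x u y uxy|b c t bct|a]; rewrite ?subst_id ?mem_head //.
- by exists x, u, y; rewrite subst_id infix_refl.
- by left; exists b, c; rewrite subst_id infix_refl.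
Qed.

Lemma renormalizes_comp d d1 d2 g h : renormalizes d d1 g -> renormalizes d1 d2 h ->
  renormalizes d d2 (fun a => subst g (h a)).
Proof.
move=> G H; split=> [x u y|x u y uxy|b c t bct|a].
- by move/(renormalizes_traj H)/(renormalizes_traj G); rewrite subst_comp.
- have [x' [u' [y' [/(renormalizes_desubst H)[z [v [w [vzw uv]]]] uu']]]] :=
    renormalizes_desubst G uxy.
  exists z, v, w; split=> //; rewrite subst_comp.
  by apply: infix_trans uu' _; exact: infix_subst.
- have [[b' [c' [bct' bc]]]|[e bce]] := renormalizes_transition G bct; last first.
    right; exists e; apply: infix_trans bce _; apply: infix_mem.
    exact: (renormalizes_mem H).
  have [[b2 [c2 [bct2 bc2]]]|[e bce]] := renormalizes_transition H bct'.
    left; exists b2, c2; split=> //; rewrite subst_comp.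
    by apply: infix_trans bc _; exact: infix_subst.
  by right; exists e; apply: infix_trans bc _; exact: infix_subst.
- rewrite mem_subst; apply/hasP; exists a.
    exact: (renormalizes_mem H).
  exact: (renormalizes_mem G).
Qed.

Lemma renormalizes_flip d d' g : renormalizes d d' g ->
  renormalizes (flip d) (flip d') (fun a => rev (g a)).
Proof.
have S u : subst (fun a => rev (g a)) u = rev (subst g (rev u)).
  by rewrite subst_rev revK.
move=> G; split=> [x u y|x u y uxy|b c t bct|a].
- rewrite S -{1}[u]revK => /traj_flip/(renormalizes_traj G) ?.
  exact/traj_flip.
- move: uxy; rewrite -{1}[u]revK => /traj_flip/(renormalizes_desubst G).
  move=> [x' [u' [y' [uxy' uu']]]]; exists y', (rev u'), x'; split.
    exact/traj_flip.
  by rewrite S revK -[u]revK infix_rev.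
- move/transition_flip: bct => /(renormalizes_transition G).
  move=> [[b' [c' [bct' bc]]]|[e bce]]; [left|right].
    exists c', b'; split; first exact/transition_flip.
    by rewrite S -[X in infix X]revK infix_rev.
  by exists e; rewrite -[X in infix X]revK infix_rev.
- rewrite mem_rev; exact: (renormalizes_mem G).
Qed.

Definition type0 d := len d (last1 d) < len d (last0 d).
Definition type1 d := len d (last0 d) < len d (last1 d).

(** Total by staying at [d] when no step is defined, with the identity as substitution. *)
Definition rauzy_next d := if rauzy_step d is Some (d', _) then d' else d.

Definition rauzy_subst d b :=
  if type0 d then twist0_subst d b
  else if type1 d then rev (twist0_subst (flip d) b) else [:: b].

Variant rauzy_step_spec d :
    option (ciet R n * automorphism n.+2) -> bool -> bool -> Prop :=
  | RauzyStep0 (h : len d (last1 d) < len d (last0 d)) :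
      rauzy_step_spec d (Some (rauzy0 h, twist0 h)) true false
  | RauzyStep1 (h : len d (last0 d) < len d (last1 d)) :
      rauzy_step_spec d (Some (rauzy1 h, twist1 h)) false true
  | RauzyStepNone : rauzy_step_spec d None false false.

Lemma rauzy_stepP d : rauzy_step_spec d (rauzy_step d) (type0 d) (type1 d).
Proof.
rewrite /rauzy_step; case: (decP (@idP (len d (last1 d) < len d (last0 d)))) => h0;
  case: (decP (@idP (len d (last0 d) < len d (last1 d)))) => h1.
- by have := lt_trans h0 h1; rewrite ltxx.
- have -> : type0 d = true := h0; have -> : type1 d = false by exact/negbTE/negP.
  exact: RauzyStep0.
- have -> : type0 d = false by exact/negbTE/negP.
  have -> : type1 d = true := h1; exact: RauzyStep1.
- have -> : type0 d = false by exact/negbTE/negP.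
  have -> : type1 d = false by exact/negbTE/negP.
  exact: RauzyStepNone.
Qed.

Lemma flipK : involutive (@flip R n). Proof. by case. Qed.

Lemma renormalizes_rauzy d : renormalizes d (rauzy_next d) (rauzy_subst d).
Proof.
rewrite /rauzy_next /rauzy_subst.
have G0 d1 (h : len d1 (last1 d1) < len d1 (last0 d1)) :
    renormalizes d1 (rauzy0 h) (twist0_subst d1).
  split; [exact: rauzy0_traj|exact: rauzy0_desubst|exact: rauzy0_transition|].
  by move=> a; rewrite /twist0_subst; case: eqP => [->|_]; rewrite mem_head.
case: rauzy_stepP => [h|h|]; first exact: G0.
(* A type 1 step of [d] is a type 0 step of [flip d]. *)
- by have := renormalizes_flip (G0 (flip d) h); rewrite flipK.
- exact: renormalizes_id.
Qed.

Lemma rauzy_step_induces d : if rauzy_step d is Some (d', s)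
  then induces s (rauzy_subst d) else rauzy_subst d =1 (fun a => [:: a]).
Proof.
rewrite /rauzy_subst; case: rauzy_stepP => [h|h|] // a.
- have -> : twist0 h (gen a) =
      (if a == last1 d then gen (last1 d) * gen (last0 d) else gen a)%g.
    exact: fg_ext_gen.
  by rewrite /twist0_subst; case: ifP => _; [rewrite pos_cons pos1|rewrite pos1].
- have -> : twist1 h (gen a) =
      (if a == last0 d then gen (last1 d) * gen (last0 d) else gen a)%g.
    exact: fg_ext_gen.
  by rewrite /twist0_subst; case: ifP => _; [rewrite /rev /= pos_cons pos1|rewrite pos1].
Qed.

Fixpoint rauzy_subst_iter i d b :=
  if i is i'.+1 then subst (rauzy_subst d) (rauzy_subst_iter i' (rauzy_next d) b)
  else [:: b].

Lemma renormalizes_iter i d :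
  renormalizes d (iter i rauzy_next d) (rauzy_subst_iter i d).
Proof.
elim: i d => [|i IH] d /=; first exact: renormalizes_id.
by rewrite -iterS iterSr; apply: renormalizes_comp (IH _); exact: renormalizes_rauzy.
Qed.

Lemma rauzy_subst_iterD i j d b : rauzy_subst_iter (i + j) d b =
  subst (rauzy_subst_iter i d) (rauzy_subst_iter j (iter i rauzy_next d) b).
Proof.
elim: i d => [|i IH] d; first by rewrite /= subst_id.
by rewrite addSn /= IH -subst_comp -iterS iterSr.
Qed.

Lemma twists_induces i d : induces (twists i d) (rauzy_subst_iter i d).
Proof.
elim: i d => [|i IH] d a /=; first by rewrite pos1.
have := rauzy_step_induces d; rewrite /rauzy_next.
case E: (rauzy_step d) => [[d' s]|] sE /=; first by rewrite IH (induces_pos _ sE).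
(* Once the induction stops, all further substitutions are the identity. *)
rewrite -pos1; congr pos; rewrite (eq_subst sE) subst_id.
elim: i {IH} => //= i IH; rewrite /rauzy_next E.
by rewrite (eq_subst sE) subst_id.
Qed.

End InductionSteps.

(** * Winners, losers and homothety *)

Section Similarity.
Variables (R : realType) (n : nat).
Implicit Types (d : ciet R n) (a b c : 'I_n.+2) (u v : seq 'I_n.+2) (x y z t e : R).
Local Open Scope ring_scope.

Definition winner d := if type0 d then last0 d else last1 d.
Definition loser d := if type0 d then last1 d else last0 d.
Definition inducible d := type0 d || type1 d.

Lemma rauzy_next_pi0 d : pi0 (rauzy_next d) =
  if type1 d then (pi0 d * slide (pi0 d (last1 d)))%g else pi0 d.
Proof. by rewrite /rauzy_next; case: rauzy_stepP. Qed.

Lemma rauzy_next_pi1 d : pi1 (rauzy_next d) =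
  if type0 d then (pi1 d * slide (pi1 d (last0 d)))%g else pi1 d.
Proof. by rewrite /rauzy_next; case: rauzy_stepP. Qed.

Lemma rauzy_next_len d a : len (rauzy_next d) a =
  if inducible d && (a == winner d) then len d a - len d (loser d) else len d a.
Proof.
rewrite /rauzy_next /inducible /winner /loser.
by case: rauzy_stepP => //= h; rewrite /Defs.shorten; case: eqP => // ->.
Qed.

Lemma winner_mem_subst d : inducible d -> winner d \in rauzy_subst d (loser d).
Proof.
rewrite /inducible /winner /loser /rauzy_subst; case: (type0 d) => /=.
  by rewrite /twist0_subst eqxx !inE eqxx orbT.
by move=> ->; rewrite /twist0_subst eqxx mem_rev !inE eqxx orbT.
Qed.

(** The order on the winner's side is unchanged, so the winner is still last there and is compared
    again in the next step. *)
Lemma winner_next d : inducible d ->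
  winner (rauzy_next d) = winner d \/ loser (rauzy_next d) = winner d.
Proof.
rewrite /inducible => dI.
have : last0 (rauzy_next d) = winner d \/ last1 (rauzy_next d) = winner d.
  rewrite /last0 /last1 rauzy_next_pi0 rauzy_next_pi1 /winner; move: dI.
  by case: rauzy_stepP => //= h _; [left|right].
rewrite /winner /loser; case: (type0 (rauzy_next d)) => -[]; tauto.
Qed.

Definition homothetic e d d' :=
  [/\ 0 < e, pi0 d' = pi0 d, pi1 d' = pi1 d & forall a, len d' a = e * len d a].

Lemma homothetic_sym e d d' : homothetic e d d' -> homothetic e^-1 d' d.
Proof.
move=> [e0 p0 p1 dl]; split=> //; first by rewrite invr_gt0.
by move=> a; rewrite dl mulKf // gt_eqF.
Qed.

Lemma homothetic_trans e e' d d' d2 :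
  homothetic e d d' -> homothetic e' d' d2 -> homothetic (e' * e) d d2.
Proof.
move=> [e0 p0 p1 dl] [e0' p0' p1' dl']; split; first exact: mulr_gt0.
- by rewrite p0'.
- by rewrite p1'.
- by move=> a; rewrite dl' dl mulrA.
Qed.

Lemma homothetic_type e d d' : homothetic e d d' ->
  (last0 d' = last0 d) * (last1 d' = last1 d) *
  (type0 d' = type0 d) * (type1 d' = type1 d).
Proof.
move=> [e0 p0 p1 dl].
have l0 : last0 d' = last0 d by rewrite /last0 p0.
have l1 : last1 d' = last1 d by rewrite /last1 p1.
by rewrite /type0 /type1 l0 l1 !dl !ltr_pM2l.
Qed.

Lemma homothetic_winner e d d' : homothetic e d d' ->
  [/\ winner d' = winner d, loser d' = loser d & inducible d' = inducible d].
Proof. by move=> s; rewrite /winner /loser /inducible !(homothetic_type s). Qed.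

Lemma homothetic_next e d d' :
  homothetic e d d' -> homothetic e (rauzy_next d) (rauzy_next d').
Proof.
move=> s; have [e0 p0 p1 dl] := s; have t := homothetic_type s.
have [w l i] := homothetic_winner s.
split=> //; first by rewrite !rauzy_next_pi0 !t p0.
- by rewrite !rauzy_next_pi1 !t p1.
- move=> a; rewrite !rauzy_next_len w l i !dl -mulrBr.
  by case: ifP.
Qed.

Lemma homothetic_iter i e d d' : homothetic e d d' ->
  homothetic e (iter i (@rauzy_next R n) d) (iter i (@rauzy_next R n) d').
Proof. by move=> s; elim: i => //= i; exact: homothetic_next. Qed.

Lemma homothetic_subst e d d' : homothetic e d d' -> rauzy_subst d' =1 rauzy_subst d.
Proof.
move=> s b; have [[[l0 l1] t0] t1] := homothetic_type s.
have l0f : last0 (flip d') = last0 (flip d) := l1.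
have l1f : last1 (flip d') = last1 (flip d) := l0.
by rewrite /rauzy_subst /twist0_subst t0 t1 l0 l1 l0f l1f.
Qed.

Lemma homothetic_subst_iter i e d d' : homothetic e d d' ->
  rauzy_subst_iter i d' =1 rauzy_subst_iter i d.
Proof.
elim: i d d' => //= i IH d d' s a.
by rewrite (eq_subst (homothetic_subst s)) (IH _ _ (homothetic_next s)).
Qed.

Lemma homothetic_move e d d' a x y : homothetic e d d' -> move d a x y ->
  move d' a (e * x) (e * y).
Proof.
move=> [e0 p0 p1 dl]; rewrite /move /dom_offset /im_offset p0 p1.
rewrite !(offsetZ _ _ dl) dl -mulrDr !ler_pM2l // => -[-> -> ->]; split=> //.
by rewrite mulrDr mulrBr.
Qed.

Lemma homothetic_transition e d d' b c t : homothetic e d d' -> transition d b c t ->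
  transition d' b c (e * t).
Proof.
move=> s [[x /(homothetic_move s) ?] [y /(homothetic_move s) ?]].
by split; [exists (e * x)|exists (e * y)].
Qed.

Lemma homothetic_total e d d' : homothetic e d d' -> total_len d' = e * total_len d.
Proof. by move=> [_ _ _ dl]; rewrite /total_len mulr_sumr; apply: eq_bigr. Qed.

Lemma rauzy_iter_next i d d' : rauzy_iter i d = Some d' ->
  iter i (@rauzy_next R n) d = d' /\
  forall j, (j < i)%N -> inducible (iter j (@rauzy_next R n) d).
Proof.
elim: i d' => [|i IH] d'; first by move=> [->].
rewrite /rauzy_iter iterS -/(rauzy_iter i d).
case E: (rauzy_iter i d) => [d1|] //=; have [id1 dI] := IH _ E.
have step : rauzy d1 = Some d' -> rauzy_next d1 = d' /\ inducible d1.
  by rewrite /rauzy /rauzy_next /inducible; case: rauzy_stepP => // h [<-].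
move=> /step[next dI1]; rewrite /= id1; split=> // j; rewrite ltnS leq_eqVlt.
by case/orP=> [/eqP ->|/dI //]; rewrite id1.
Qed.

End Similarity.

(** * Iterated substitutions and their factors *)

Section Iteration.
Variable T : eqType.
Implicit Types (f : T -> seq T) (u v w : seq T).

Lemma iter_substE f i u :
  iter i (subst f) u = subst (fun a => iter i (subst f) [:: a]) u.
Proof.
elim: u => [|a u IH]; first by elim: i => //= i ->.
by rewrite -cat1s iter_subst_cat IH.
Qed.

Lemma infix_iter_subst f i u v :
  infix u v -> infix (iter i (subst f) u) (iter i (subst f) v).
Proof. by move=> uv; elim: i => //= i; exact: infix_subst. Qed.

Lemma size_subst_ge f k w : (forall a, k <= size (f a)) -> size w * k <= size (subst f w).
Proof.
by move=> fk; elim: w => // a w IH; rewrite subst_cons size_cat mulSn leq_add.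
Qed.

Lemma size_iter_subst_ge f i w : (forall a, 0 < size (f a)) ->
  size w <= size (iter i (subst f) w).
Proof.
move=> f0; elim: i => //= i IH; apply: leq_trans IH _.
by rewrite -{1}[size (iter _ _ _)]muln1; exact: size_subst_ge.
Qed.

(** Exponents are multiples of [k], like the powers of phi that build the attracting point. *)
Definition factor_language f a k u : Prop :=
  exists j, infix u (iter (j * k) (subst f) [:: a]).

End Iteration.

(** Take an index at which the cardinal, bounded by that of [T], is maximal. *)
Lemma increasing_sets_stable (T : finType) (A : nat -> {set T}) :
  (forall i, A i \subset A i.+1) -> exists i0, forall i, i0 <= i -> A i = A i0.
Proof.
move=> AS; have mono i j : i <= j -> A i \subset A j.
  move/subnK <-; elim: (j - i) => // k IH.
  by rewrite addSn; exact: fintype.subset_trans IH (AS _).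
pose P k := `[< exists i, #|A i| = k >].
have P0 : exists k, P k by exists #|A 0|; apply/asboolP; exists 0.
have PT k : P k -> k <= #|T| by move=> /asboolP[i <-]; exact: max_card.
case: (ex_maxnP P0 PT) => k /asboolP[i0 <-] kmax; exists i0 => i i0i.
by apply/eqP; rewrite eq_sym eqEcard mono //=; apply: kmax; apply/asboolP; exists i.
Qed.

(** * Self-similarity, primitivity and the common language *)

Section SelfSimilar.
Variables (R : realType) (n : nat) (d : ciet R n) (m : nat) (e : R).
Hypothesis m_gt0 : 0 < m.
Hypothesis d_homothetic : homothetic e d (iter m (@rauzy_next R n) d).
Hypothesis d_inducible : forall i, i < m -> inducible (iter i (@rauzy_next R n) d).
Local Notation D i := (iter i (@rauzy_next R n) d).
Local Notation f := (rauzy_subst_iter m d).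

Lemma homothetic_iterX j : homothetic (e ^+ j)%R d (D (j * m)).
Proof.
elim: j => [|j IH]; first by split=> //; rewrite ?expr0 // => a; rewrite mul1r.
rewrite mulSn iterD exprSr.
exact: homothetic_trans d_homothetic (homothetic_iter _ IH).
Qed.

(** Induction commutes with homothety, so [i] can be reduced modulo the period. *)
Lemma self_similar_inducible i : inducible (D i).
Proof.
have s := homothetic_iter (i %% m) (homothetic_iterX (i %/ m)).
have [_ _] := homothetic_winner s; rewrite -iterD addnC -divn_eq => ->.
by apply: d_inducible; rewrite ltn_mod.
Qed.

Lemma len_next_le (d1 : ciet R n) a :
  inducible d1 -> (len (rauzy_next d1) a <= len d1 a)%R.
Proof.
move=> dI; rewrite rauzy_next_len dI /=; case: eqP => // _.
by rewrite gerBl ltW // len_gt0.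
Qed.

Lemma len_iter_le i j a : i <= j -> (len (D j) a <= len (D i) a)%R.
Proof.
move/subnK <-; elim: (j - i) => // k IH; apply: le_trans IH.
by rewrite addSn iterS; apply: len_next_le; exact: self_similar_inducible.
Qed.

(** Lengths never grow, and the first winner is strictly shortened. *)
Lemma ratio_lt1 : (e < 1)%R.
Proof.
have [e0 _ _ dl] := d_homothetic; set w := winner d.
have dI := self_similar_inducible 0.
have : (len (D m) w < len d w)%R.
  apply: le_lt_trans (len_iter_le _ m_gt0) _.
  by rewrite /= rauzy_next_len [inducible d]dI eqxx /= gtrBl len_gt0.
by rewrite dl gtr_pMl // len_gt0.
Qed.

(** A letter that does not win during a period keeps its length, whereas the period multiplies every
    length by e < 1. *)
Lemma winner_recurrent b i : exists2 j, i <= j & winner (D j) = b.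
Proof.
have [r rm rb] : exists2 r, r < m & winner (D r) = b.
  apply: contrapT => nb.
  have lenD r : r <= m -> len (D r) b = len d b.
    elim: r => // r IH rm; rewrite iterS rauzy_next_len IH ?(ltnW rm) //.
    by case: eqP => [bw|]; [case: nb; exists r|rewrite andbF].
  have [e0 _ _ dl] := d_homothetic; have := ratio_lt1.
  by rewrite -(gtr_pMl _ (len_gt0 d b)) -dl lenD // ltxx.
exists (r + i * m).
  by apply: leq_trans (leq_addl _ _); rewrite leq_pmulr.
have [wr _ _] := homothetic_winner (homothetic_iter r (homothetic_iterX i)).
by rewrite iterD wr.
Qed.

Lemma rauzy_subst_iterS i (d1 : ciet R n) a :
  rauzy_subst_iter i.+1 d1 a =
  subst (rauzy_subst_iter i d1) (rauzy_subst (iter i (@rauzy_next R n) d1) a).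
Proof.
by have := rauzy_subst_iterD i 1 d1 a; rewrite addn1 [rauzy_subst_iter 1 _ _]subst1.
Qed.

(* The set W of letters whose image contains [b] is eventually stable.  Then a *)
(* winner in W forces the loser into W, and a new winner has just beaten the   *)
(* previous one, so W contains all earlier winners; every letter is one.       *)
Lemma mem_subst_iter_eventually b :
  exists i0, forall i, i0 <= i -> forall a, b \in rauzy_subst_iter i d a.
Proof.
pose A i := [set a | b \in rauzy_subst_iter i d a].
have AS i : A i \subset A i.+1.
  apply/fintype.subsetP => a; rewrite !inE rauzy_subst_iterS mem_subst => ba.
  by apply/hasP; exists a => //; exact: (renormalizes_mem (renormalizes_rauzy _)).
have [i0 Ai0] := increasing_sets_stable AS; exists i0 => i i0i.
have loserW j : i0 <= j -> winner (D j) \in A i0 -> loser (D j) \in A i0.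
  move=> i0j; rewrite -{2}(Ai0 j.+1) ?(leq_trans i0j) // -(Ai0 j) // !inE => bw.
  rewrite rauzy_subst_iterS mem_subst; apply/hasP; exists (winner (D j)) => //.
  exact: winner_mem_subst (self_similar_inducible j).
have prevW j : i0 <= j -> winner (D j.+1) \in A i0 -> winner (D j) \in A i0.
  move=> i0j wA; have [<- //|<-] := winner_next (self_similar_inducible j).
  by apply: (loserW j.+1) => //; exact: leqW.
have backW j k : i0 <= j -> winner (D (k + j)) \in A i0 -> winner (D j) \in A i0.
  move=> i0j; elim: k => // k IH wA; apply: IH; apply: prevW wA.
  exact: leq_trans i0j (leq_addl _ _).
have bA : b \in A i0.
  rewrite inE; apply: (renormalizes_mem (renormalizes_iter _ _)).
move=> a; suff : a \in A i by rewrite inE.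
rewrite Ai0 //; have [j i0j wa] := winner_recurrent a i0.
have [k jk wb] := winner_recurrent b j.
by rewrite -wa; apply: (backW j (k - j)) => //; rewrite subnK // wb.
Qed.

Lemma subst_iterX j a : rauzy_subst_iter (j * m) d a = iter j (subst f) [:: a].
Proof.
elim: j a => [//|j IH] a; rewrite mulSn rauzy_subst_iterD iterS -IH.
congr (subst _ _); exact: (homothetic_subst_iter _ d_homothetic).
Qed.

Lemma subst_iterXE j u : subst (rauzy_subst_iter (j * m) d) u = iter j (subst f) u.
Proof. by rewrite iter_substE; apply: eq_subst => a; exact: subst_iterX. Qed.

Lemma self_similar_primitive :
  exists2 K, 0 < K & forall k, K <= k -> forall a b, b \in iter k (subst f) [:: a].
Proof.
have [i0 i0P] := choice mem_subst_iter_eventually.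
exists (\max_b i0 b).+1 => // k Kk a b; rewrite -subst_iterX; apply: i0P.
apply: leq_trans (leq_bigmax b) _; apply: leq_trans (ltnW Kk) _.
by rewrite leq_pmulr.
Qed.

Lemma subst_nonempty a : 1 <= size (f a).
Proof. by have := renormalizes_mem (renormalizes_iter m d) a; case: (f a). Qed.

(** Each image under f^K contains all letters, of which there are at least two, so f^K at least
    doubles lengths. *)
Lemma size_iter_unbounded k : exists j, forall a, k <= size (iter j (subst f) [:: a]).
Proof.
have [K K0 KP] := self_similar_primitive.
have K2 a : 2 <= size (iter K (subst f) [:: a]).
  apply: (@leq_trans #|'I_n.+2|); first by rewrite card_ord.
  rewrite cardE; apply: uniq_leq_size (enum_uniq _) _ => b _; exact: KP.
suff [j jP] : exists j, forall a, k.+1 <= size (iter j (subst f) [:: a]).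
  by exists j => a; exact: ltnW.
elim: k => [|k [j IH]]; first by exists 0.
exists (K + j) => a; rewrite iterD iter_substE.
by apply: leq_trans (size_subst_ge _ K2); have := IH a; lia.
Qed.

(** By primitivity [c] occurs in f^r(a) for all r >= K, so the exponent can be completed to a
    multiple of [k]. *)
Lemma factor_language_iter a k u i c : 0 < k ->
  infix u (iter i (subst f) [:: c]) -> factor_language f a k u.
Proof.
move=> k0 uc; have [K _ KP] := self_similar_primitive; exists (i + K).
have -> : (i + K) * k = i + ((i + K) * k - i).
  by rewrite subnKC // (leq_trans (leq_addr K i)) // leq_pmulr.
rewrite iterD; apply: infix_trans uc _; apply: infix_iter_subst.
rewrite infix1s; apply: KP; rewrite leq_subRL; last first.
  by rewrite (leq_trans (leq_addr K i)) // leq_pmulr.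
by rewrite leq_pmulr.
Qed.

Lemma transition_factor b c t : transition d b c t ->
  exists i a, infix [:: b; c] (iter i (subst f) [:: a]).
Proof.
wlog t0 : t / (0 < t)%R => [W|] bct.
  have [[x bx] [y cy]] := bct; have /andP[t0 _] := move_im bx.
  move: t0; rewrite le_eqVlt => /orP[/eqP t0|t0]; last exact: W bct.
  have b0 := len_gt0 d b; have c0 := len_gt0 d c.
  have ib : im_offset d b = 0%R.
    apply/eqP; rewrite eq_le offset_ge0 ?andbT; last exact: len_gt0.
    by move/move_flip: bx => [+ _ _]; rewrite -t0.
  have dc : dom_offset d c = 0%R.
    apply/eqP; rewrite eq_le offset_ge0 ?andbT; last exact: len_gt0.
    by case: cy => [+ _ _]; rewrite -t0.
  (* Both intervals start at 0, so [s] is a positive point of each. *)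
  pose s := Num.min (len d b) (len d c).
  have s0 : (0 < s)%R by rewrite lt_min b0 c0.
  have sb : (s <= len d b)%R by rewrite ge_min lexx.
  have sc : (s <= len d c)%R by rewrite ge_min lexx orbT.
  apply: (W s s0); split.
    by exists (s + dom_offset d b)%R; rewrite /move ib; split; lra.
  by exists (s + im_offset d c)%R; rewrite /move dc; split; lra.
have e0 : (0 < e)%R by have [] := d_homothetic.
have [i it] : exists i, (e ^+ i * total_len d < t)%R.
  have ne : (`|e| < 1)%R by rewrite gtr0_norm // ratio_lt1.
  have [i it] := filter_ex (cvgr_lt _ (cvg_geometric (total_len d) ne) _ t0).
  by exists i; rewrite mulrC.
(* A transition of the induced system at [t] would force t <= e^i |lambda|. *)
have [[b' [c' [[_ [y /move_dom/andP[_ tT]]] _]]]|[a bca]] :=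
  renormalizes_transition (renormalizes_iter (i * m) d) bct.
  by move: tT; rewrite (homothetic_total (homothetic_iterX i)) leNgt it.
by exists i, a; rewrite -subst_iterX.
Qed.

Lemma admissible_factor a k u : 0 < k ->
  (exists x y, traj d x u y) <-> factor_language f a k u.
Proof.
move=> k0; split=> [[x [y]]|[j uj]]; last first.
  have [x [y]] := traj_exists (D (j * k * m)) a.
  move=> /(renormalizes_traj (renormalizes_iter _ _)).
  by rewrite subst_iterXE; exact: traj_infix.
have [->|u0] := eqVneq u [::]; first by exists 0.
(* Images under f^J are at least as long as [u]. *)
have [J JP] := size_iter_unbounded (size u).
move=> /(renormalizes_desubst (renormalizes_iter (J * m) d)).
move=> [x' [u' [y' [uxy' uu']]]]; case: (infix_subst_pair _ _ uu').
- by rewrite lt0n size_eq0.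
- by move=> b; rewrite subst_iterX.
- by move=> [b]; rewrite subst_iterX; exact: factor_language_iter.
move=> [b [c [bcu']]]; rewrite subst_iterXE.
have [x2 [y2 [t bt /traj1 ct]]] := traj_infix bcu' uxy'.
have bct : transition (D (J * m)) b c t by split; [exists x2|exists y2].
(* The induced system is a rescaled [d], so the pair is also a transition of [d]. *)
have := homothetic_transition (homothetic_sym (homothetic_iterX J)) bct.
move=> /transition_factor[i [c' ic']] /infix_trans ubc.
apply: (@factor_language_iter _ _ _ (J + i) c') => //; apply: ubc.
by rewrite iterD; exact: infix_iter_subst.
Qed.

End SelfSimilar.

(** * Cylinders as a base of the boundary topology *)

Section BoundaryTopology.
Variable N : nat.
Implicit Types (V W : boundary N) (P Q : boundary N * boundary N).
Local Open Scope classical_set_scope.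

Lemma boundary_ext V W : (forall i, V i = W i) -> V = W.
Proof.
case: V W => v vP [w wP] /= vw; have E : v = w by exact/funext.
by subst w; congr Boundary; exact: Prop_irrelevance.
Qed.

Definition cylinder W m : set (boundary N) := [set V | forall i, i < m -> V i = W i].

Lemma nbhs_letter W i : nbhs W [set V : boundary N | V i = W i].
Proof.
have cr := @initial_continuous (boundary N) {ptws nat -> discrete_topology (letter N)}
  (@ray N) W.
have cp := @proj_continuous nat (fun=> discrete_topology (letter N)) i (ray W).
apply: (cr (fun h => h i = W i)); apply: (cp (fun x => x = W i)).
by rewrite /nbhs /=; exact/principal_filterP.
Qed.

Lemma nbhs_cylinder W m : nbhs W (cylinder W m).
Proof.
elim: m => [|m IH]; first by apply: filterS filterT => V _ i.
apply: filterS (filterI IH (nbhs_letter W m)) => V [Vm VWm] i.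
by rewrite ltnS leq_eqVlt => /orP[/eqP ->|/Vm].
Qed.

(** Otherwise points outside [B] agree with [W] on ever longer prefixes; they converge to [W]
    pointwise, hence enter [B]. *)
Lemma cylinder_sub_nbhs W (B : set (boundary N)) :
  nbhs W B -> exists m, cylinder W m `<=` B.
Proof.
move=> WB; apply: contrapT => nB.
have /choice[V VP] m : exists V, cylinder W m V /\ ~ B V.
  apply: contrapT => nV; apply: nB; exists m => V VWm; apply: contrapT => nBV.
  by apply: nV; exists V.
move: WB; rewrite nbhsE => -[A [[U Uop UA] AW] AB].
have VW : {ptws, (fun m => ray (V m)) @ \oo -->
    (ray W : nat -> discrete_topology (letter N))}.
  apply/(@pointwise_cvgP nat (discrete_topology (letter N))) => i X /=.
  move=> /principal_filterP XW.
  exists i.+1 => // m im; rewrite /= (VP m).1 //.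
have [m Um] : exists m, U (ray (V m)).
  apply: (@filter_ex _ \oo); apply: VW; apply: open_nbhs_nbhs; split=> //.
  by move: AW; rewrite -UA.
by apply: (VP m).2; apply: AB; rewrite -UA.
Qed.

Lemma closure_cylinder (E : set (boundary N * boundary N)) P :
  closure E P <->
  forall m, exists Q, [/\ E Q, cylinder P.1 m Q.1 & cylinder P.2 m Q.2].
Proof.
split=> [clE m|EP B [[B1 B2] [/= PB1 PB2] B12]].
  have [Q [EQ [Q1 Q2]]] := clE _ (ex_intro2 _ _ (cylinder P.1 m, cylinder P.2 m)
    (conj (nbhs_cylinder P.1 m) (nbhs_cylinder P.2 m)) (fun Q => id)).
  by exists Q.
have [m1 m1B] := cylinder_sub_nbhs PB1; have [m2 m2B] := cylinder_sub_nbhs PB2.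
have [Q [EQ Q1 Q2]] := EP (maxn m1 m2); exists Q; split=> //; apply: B12; split=> /=.
  by apply: m1B => i im; apply: Q1; rewrite leq_max im.
by apply: m2B => i im; apply: Q2; rewrite leq_max im orbT.
Qed.

End BoundaryTopology.

(** * Positive pairs as bi-infinite words *)

Section Coordinates.
Variable N : nat.
Implicit Types (P Q : boundary N * boundary N) (z k : int).

Definition positive_pair P := forall i, ~~ (P.1 i).2 /\ (P.2 i).2.

(* (U, V) is read as the bi-infinite word ... U_1^-1 U_0^-1 V_0 V_1 ..., whose *)
(* letter of index 0 is V_0.                                                   *)
Definition coord P z : 'I_N :=
  match z with Posz i => (P.2 i).1 | Negz i => (P.1 i).1 end.

Lemma positive_pairE P i : positive_pair P ->
  P.1 i = (coord P (Negz i), false) /\ P.2 i = (coord P (Posz i), true).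
Proof.
by move=> /(_ i); rewrite /coord; case: (P.1 i) (P.2 i) => a [] // [b []] [].
Qed.

Lemma positive_pair_neq P : positive_pair P -> boundary2 P.
Proof. by move=> /(_ 0)[+ +] P12; rewrite P12 => /negP. Qed.

(** The inverse of the first letter cancels on the positive ray and never on the negative one, so
    the shift only moves the origin. *)
Lemma shift2_coord P : positive_pair P ->
  positive_pair (shift2 P) /\ forall z, coord (shift2 P) z = coord P (z + 1)%R.
Proof.
move=> pP; have [P10 P20] := positive_pairE 0 pP.
have L1 : ray (shift2 P).1 =1
    (fun i => if i is j.+1 then P.1 j else (coord P 0%R, false)).
  by move=> i; rewrite /shift2 /= /lact_ray P10 P20 /inv_letter /= xpair_eqE andbF.
have L2 : ray (shift2 P).2 =1 (fun i => P.2 i.+1).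
  by move=> i; rewrite /shift2 /= /lact_ray P20 inv_letterK eqxx.
split=> [i|[i|[|i]]]; rewrite /coord ?L1 ?L2.
- by split; [case: i => // i; have [] := pP i|have [] := pP i.+1].
- by rewrite -PoszD addn1.
- by [].
- by have -> : (Negz i.+1 + 1)%R = Negz i by lia.
Qed.

Lemma unshift2_coord P : positive_pair P ->
  positive_pair (unshift2 P) /\ forall z, coord (unshift2 P) z = coord P (z - 1)%R.
Proof.
move=> pP; have [P10 P20] := positive_pairE 0 pP.
have L2 : ray (unshift2 P).2 =1
    (fun i => if i is j.+1 then P.2 j else (coord P (-1)%R, true)).
  by move=> i; rewrite /unshift2 /= /lact_ray P10 P20 /inv_letter /= xpair_eqE andbF.
have L1 : ray (unshift2 P).1 =1 (fun i => P.1 i.+1).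
  by move=> i; rewrite /unshift2 /= /lact_ray P10 inv_letterK eqxx.
split=> [i|[[|i]|i]]; rewrite /coord ?L1 ?L2.
- by split; [have [] := pP i.+1|case: i => // i; have [] := pP i].
- by [].
- by have -> : (Posz i.+1 - 1)%R = Posz i by lia.
- by have -> : (Negz i - 1)%R = Negz i.+1 by lia.
Qed.

Lemma shift2z_coord k P : positive_pair P ->
  positive_pair (shift2z k P) /\ forall z, coord (shift2z k P) z = coord P (z + k)%R.
Proof.
move=> pP; case: k => k /=.
  elim: k => [|k [pS IH]]; first by split=> // z; rewrite addr0.
  have [pSS SS] := shift2_coord pS; split=> // z; rewrite SS IH; congr coord; lia.
have U0 := unshift2_coord pP.
elim: k => [//|k [pS IH]].
have [pSS SS] := unshift2_coord pS; split=> // z; rewrite SS IH; congr coord; lia.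
Qed.

Definition window P z (k : nat) : seq 'I_N := mkseq (fun i => coord P (z + i%:Z)%R) k.

(** Indices run from -m to m - 1, which gives the first [m] letters of each ray. *)
Definition central_window P m := window P (- m%:Z)%R (m + m).

Lemma central_windowE P m : central_window P m =
  rev [seq x.1 | x <- mkseq P.1 m] ++ [seq x.1 | x <- mkseq P.2 m].
Proof.
apply: (@eq_from_nth _ (P.2 0).1).
  by rewrite size_mkseq size_cat size_rev !size_map size_iota.
move=> i; rewrite size_mkseq => im.
rewrite nth_mkseq // nth_cat size_rev !size_map size_iota.
case: ltnP => mi.
  rewrite nth_rev ?size_map ?size_iota // (nth_map (P.2 0)) ?size_mkseq; last by lia.
  rewrite nth_mkseq; last by lia.
  by have -> : (- m%:Z + i%:Z)%R = Negz (m - i.+1) by lia.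
rewrite (nth_map (P.2 0)) ?size_mkseq; last by lia.
rewrite nth_mkseq; last by lia.
by have -> : (- m%:Z + i%:Z)%R = Posz (i - m) by lia.
Qed.

Lemma infix_window P z (k m i : nat) :
  i + m <= k -> infix (window P (z + i%:Z)%R m) (window P z k).
Proof.
move=> imk; have -> : window P (z + i%:Z)%R m = take m (drop i (window P z k)).
  apply: (@eq_from_nth _ (P.2 0).1).
    by rewrite size_take size_drop !size_mkseq; case: ltnP => //; lia.
  move=> j; rewrite size_mkseq => jm.
  rewrite nth_take // nth_drop !nth_mkseq //; last by lia.
  by rewrite PoszD addrA.
exact: infix_trans (infix_take _ _) (infix_drop _ _).
Qed.

Lemma infix_windowP P z (k : nat) u : infix u (window P z k) ->
  exists z', u = window P z' (size u).
Proof.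
move=> /infixP[p [s E]]; exists (z + (size p)%:Z)%R.
apply: (@eq_from_nth _ (P.2 0).1); rewrite ?size_mkseq // => i iu.
have ik : size p + i < k.
  move: (congr1 size E); rewrite size_mkseq !size_cat => ->.
  by rewrite ltn_add2l ltn_addr.
have := congr1 (fun w => nth (P.2 0).1 w (size p + i)) E.
rewrite /= nth_mkseq // PoszD addrA [RHS]nth_cat ltnNge leq_addr /= addKn.
rewrite nth_cat iu => <-.
by rewrite nth_mkseq.
Qed.

Lemma window_cylinder P Q m : positive_pair P -> positive_pair Q ->
  central_window Q m = central_window P m <-> cylinder P.1 m Q.1 /\ cylinder P.2 m Q.2.
Proof.
move=> pP pQ; rewrite !central_windowE; split=> [|[Q1 Q2]]; last first.
  congr (rev _ ++ _); congr map; apply/eq_in_map => i; rewrite mem_iota /= => im.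
    exact: Q1.
  exact: Q2.
move/eqP; rewrite eqseq_cat ?size_rev ?size_map // => /andP[/eqP/(can_inj revK) + /eqP].
rewrite -!map_comp => E1 E2; split=> i im.
  have /= [-> _] := positive_pairE i pP; have /= [-> _] := positive_pairE i pQ.
  by congr pair; move: E1 => /eq_in_map/(_ i); rewrite mem_iota => /(_ im).
have /= [_ ->] := positive_pairE i pP; have /= [_ ->] := positive_pairE i pQ.
by congr pair; move: E2 => /eq_in_map/(_ i); rewrite mem_iota => /(_ im).
Qed.

End Coordinates.

(** * The subshift of the CIET through its finite words *)

Section CietSubshift.
Variables (R : realType) (n : nat).
Implicit Types (d : ciet R n) (u v : seq 'I_n.+2) (x y t : R).
Local Open Scope ring_scope.

Lemma piso_word_pos d u t y :
  piso_word d [seq (a, true) | a <- u] t = Some y <-> traj d t u y.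
Proof.
have foldN (w : seq (letter n.+2)) :
    foldl (fun o l => obind (piso d l) o) None w = None by elim: w.
rewrite /piso_word; elim: u t => [|a u IH] t /=; first by split=> [[]|->].
rewrite -/(dom_offset d a) -/(im_offset d a); split.
  case: ifP => [/andP[h1 h2] /IH ty|_]; first by eexists; last exact: ty.
  by rewrite foldN.
by case=> z [h1 h2 ->] /IH; rewrite h1 h2.
Qed.

(** Inverse letters act as the isometries of [flip d], and [flip] reverses trajectories. *)
Lemma piso_word_neg d u t x :
  piso_word d [seq (a, false) | a <- u] t = Some x <-> traj d x (rev u) t.
Proof.
have -> : piso_word d [seq (a, false) | a <- u] t =
    piso_word (flip d) [seq (a, true) | a <- u] t.
  by rewrite /piso_word; elim: u (Some t) => //= a u IH o; rewrite IH; case: o.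
apply: (iff_trans (piso_word_pos _ _ _ _)).
by rewrite -{1}[u]revK; exact: traj_flip.
Qed.

(** Every left endpoint is below every right endpoint, so the supremum of the left ones is a common
    point. *)
Lemma nested_intervals (lo hi : nat -> R) :
  (forall i t, lo i.+1 <= t <= hi i.+1 -> lo i <= t <= hi i) ->
  (forall i, exists t, lo i <= t <= hi i) -> exists t, forall i, lo i <= t <= hi i.
Proof.
move=> nest ex.
have nestD i k t : lo (k + i)%N <= t <= hi (k + i)%N -> lo i <= t <= hi i.
  by elim: k => // k IH /nest.
have lohi i j : lo i <= hi j.
  have [t tij] := ex (i + j)%N; have /andP[_ tj] := nestD _ _ _ tij.
  move: tij; rewrite addnC => /nestD/andP[it _]; exact: le_trans it tj.
exists (sup (range lo)) => i; apply/andP; split.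
  apply: ub_le_sup; last by exists i.
  by exists (hi 0%N) => _ [j _ <-].
by apply: ge_sup; [exists (lo 0%N), 0%N|move=> _ [j _ <-]].
Qed.

(** Each letter intersects the domain with a translated closed interval; [lo] exceeds [hi] if no
    point follows the word. *)
Lemma traj_dom_interval d a u : exists lo hi, forall t,
  (exists y, traj d t (a :: u) y) <-> lo <= t <= hi.
Proof.
elim: u a => [|b u IH] a.
  exists (dom_offset d a), (dom_offset d a + len d a) => t.
  split=> [[y /traj1[h1 h2 _]]|/andP[h1 h2]]; first exact/andP.
  by eexists; apply/traj1; split.
have [lo [hi E]] := IH b; set c := im_offset d a - dom_offset d a.
exists (Num.max (dom_offset d a) (lo - c)).
exists (Num.min (dom_offset d a + len d a) (hi - c)) => t.
rewrite ge_max le_min; split=> [[y [z [h1 h2 h3] zy]]|].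
  have /andP[? ?] : lo <= z <= hi by apply/E; exists y.
  by apply/andP; split; apply/andP; split=> //; rewrite /c; lra.
move=> /andP[/andP[h1 h2] /andP[h3 h4]].
have /E[y ty] : lo <= t - dom_offset d a + im_offset d a <= hi.
  by apply/andP; split; move: h2 h4; rewrite /c; lra.
by exists y; exists (t - dom_offset d a + im_offset d a).
Qed.

Lemma traj_prefix d t u v y : traj d t (u ++ v) y -> exists z, traj d t u z.
Proof. by move=> /traj_cat[z uz _]; exists z. Qed.

Local Notation letters V m := [seq l.1 | l <- mkseq V m].

Let lettersS (V : nat -> letter n.+2) m :
  letters V m.+1 = (V 0%N).1 :: letters (fun i => V i.+1) m.
Proof. by rewrite /mkseq /= (iotaDl 1 0) -map_comp. Qed.

Let letters_rcons (V : nat -> letter n.+2) m :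
  letters V m.+1 = letters V m ++ [:: (V m).1].
Proof. by rewrite mkseqS map_rcons cats1. Qed.

(** For the converse, the points that follow both rays for m + 1 letters form nested nonempty
    compact intervals, and a common point serves as base point. *)
Lemma ciet_subshiftP d (P : boundary n.+2 * boundary n.+2) :
  ciet_subshift d P <-> positive_pair P /\
    forall m, exists x y, traj d x (central_window P m) y.
Proof.
have words m : positive_pair P ->
    mkseq P.1 m = [seq (a, false) | a <- letters P.1 m] /\
    mkseq P.2 m = [seq (a, true) | a <- letters P.2 m].
  move=> pP; rewrite -!map_comp; split; apply: eq_map => i /=.
    by have [-> _] := positive_pairE i pP.
  by have [_ ->] := positive_pairE i pP.
split=> [[t _ [_ tP]]|[pP tP]].
  have pP : positive_pair P by move=> i; have [] := tP i.
  split=> // m; suff [x [y xy]] : exists x y, traj d x (central_window P m.+1) y.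
    apply: traj_infix xy; rewrite /central_window.
    have -> : (- m%:Z)%R = (- m.+1%:Z + 1%N%:Z)%R by lia.
    by apply: infix_window; lia.
  have [_ _] := tP m; have [-> ->] := words m.+1 pP.
  case E1: (piso_word _ _ _) => [x|] // _; case E2: (piso_word _ _ _) => [y|] // _.
  exists x, y; rewrite central_windowE; apply/traj_cat.
  by exists t; [exact/piso_word_neg|exact/piso_word_pos].
(* Words of length m + 1 are used because every real number follows the empty word. *)
have /choice[lo1 /choice[hi1 K1]] m :=
  traj_dom_interval (flip d) (P.1 0%N).1 (letters (fun i => P.1 i.+1) m).
have /choice[lo2 /choice[hi2 K2]] m :=
  traj_dom_interval d (P.2 0%N).1 (letters (fun i => P.2 i.+1) m).
have {}K1 m t : (exists y, traj (flip d) t (letters P.1 m.+1) y) <-> lo1 m <= t <= hi1 m.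
  by rewrite lettersS; exact: K1.
have {}K2 m t : (exists y, traj d t (letters P.2 m.+1) y) <-> lo2 m <= t <= hi2 m.
  by rewrite lettersS; exact: K2.
have both m t : Num.max (lo1 m) (lo2 m) <= t <= Num.min (hi1 m) (hi2 m) <->
    (lo1 m <= t <= hi1 m) /\ (lo2 m <= t <= hi2 m).
  rewrite ge_max le_min; split=> [/andP[/andP[-> ->] /andP[-> ->]] //|].
  by move=> [/andP[-> ->] /andP[-> ->]].
have [t tI] : exists t, forall m,
    Num.max (lo1 m) (lo2 m) <= t <= Num.min (hi1 m) (hi2 m).
  apply: nested_intervals => [m t /both[/K1[y1 ty1] /K2[y2 ty2]]|m].
    apply/both; split; [apply/K1|apply/K2].
      by move: ty1; rewrite letters_rcons => /traj_prefix.
    by move: ty2; rewrite letters_rcons => /traj_prefix.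
  have [x [y]] := tP m.+1; rewrite central_windowE => /traj_cat[t xt ty].
  exists t; apply/both; split; [apply/K1|apply/K2; by exists y].
  by exists x; rewrite -[letters _ _]revK; exact/traj_flip.
have tR m : exists y, traj d t (letters P.2 m.+1) y by apply/K2; have /both[] := tI m.
have tL m : exists x, traj d x (rev (letters P.1 m.+1)) t.
  have /both[/K1[x tx] _] := tI m; exists x; apply/traj_flip.
  by rewrite revK.
exists t => /=.
  by have [y /traj1/move_dom] := tR 0%N.
split=> [|m]; first exact: positive_pair_neq.
have [P1 P2] := pP m; have [-> ->] := words m.+1 pP; split=> //.
  by have [x /piso_word_neg ->] := tL m.
by have [y /piso_word_pos ->] := tR m.
Qed.

End CietSubshift.

(** * The attracting point and the attracting subshift *)

Lemma cvg_boundary_unique N (w : nat -> free_group N) (V V' : boundary N) :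
  cvg_boundary w V -> cvg_boundary w V' -> V = V'.
Proof.
move=> wV wV'; apply: boundary_ext => i.
have [j [E E']] := filter_ex (filterI (wV i.+1) (wV' i.+1)).
have := congr1 (fun u => nth (V i) u i) (etrans (esym E) E').
by rewrite !nth_mkseq.
Qed.

Section AttractingPoint.
Variables (N : nat) (phi : automorphism N) (g : 'I_N -> seq 'I_N).
Hypothesis phi_g : induces phi g.
Hypothesis g_gt0 : forall a, 0 < size (g a).
Variables (a : 'I_N) (k : nat) (p s : seq 'I_N).
Hypothesis p_gt0 : 0 < size p.
Hypothesis s_gt0 : 0 < size s.
Hypothesis phi_a : iter k (subst g) [:: a] = p ++ a :: s.

(** With [right_word], the two halves of f^(ik)(a), cut just before the occurrence of [a] singled
    out by p a s at each stage. *)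
Fixpoint left_word i :=
  if i is j.+1 then iter (j * k) (subst g) p ++ left_word j else [::].
Fixpoint right_word i :=
  if i is j.+1 then right_word j ++ iter (j * k) (subst g) s else [:: a].

Lemma left_right_word i : iter (i * k) (subst g) [:: a] = left_word i ++ right_word i.
Proof.
elim: i => // i IH; rewrite mulSn addnC iterD phi_a -cat1s !iter_subst_cat IH /=.
by rewrite !catA.
Qed.

Lemma size_left_word i : i <= size (left_word i).
Proof.
elim: i => //= i IH; rewrite size_cat -add1n leq_add //.
exact: leq_trans p_gt0 (size_iter_subst_ge _ _ g_gt0).
Qed.

Lemma size_right_word i : i < size (right_word i).
Proof.
elim: i => //= i IH; rewrite size_cat -addn1 leq_add //.
exact: leq_trans s_gt0 (size_iter_subst_ge _ _ g_gt0).
Qed.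

Lemma prefix_right_word i l : exists t, right_word (l + i) = right_word i ++ t.
Proof.
elim: l => [|l [t IH]]; first by exists [::]; rewrite cats0.
by rewrite addSn /= IH; eexists; rewrite -catA.
Qed.

Lemma suffix_left_word i l : exists t, left_word (l + i) = t ++ left_word i.
Proof.
elim: l => [|l [t IH]]; first by exists [::].
by rewrite addSn /= IH; eexists; rewrite catA.
Qed.

Lemma nth_right_word i j m : m < size (right_word i) -> m < size (right_word j) ->
  nth a (right_word i) m = nth a (right_word j) m.
Proof.
wlog ij : i j / i <= j => [W|] mi mj.
  by case/orP: (leq_total i j) => /W => [|E]; [|apply/esym]; auto.
by rewrite -(subnK ij); have [t ->] := prefix_right_word i (j - i); rewrite nth_cat mi.
Qed.

Lemma nth_left_word i j m : m < size (left_word i) -> m < size (left_word j) ->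
  nth a (rev (left_word i)) m = nth a (rev (left_word j)) m.
Proof.
wlog ij : i j / i <= j => [W|] mi mj.
  by case/orP: (leq_total i j) => /W => [|E]; [|apply/esym]; auto.
rewrite -(subnK ij); have [t ->] := suffix_left_word i (j - i).
by rewrite rev_cat nth_cat size_rev mi.
Qed.

Lemma prod_right i :
  (gen a * \prod_(0 <= j < i) iter (j * k) phi (pos s))%g = pos (right_word i).
Proof.
elim: i => [|i IH]; first by rewrite big_geq // mulg1 pos1.
by rewrite big_nat_recr //= mulgA IH (induces_iter _ _ phi_g) pos_cat.
Qed.

Lemma prod_left i :
  (\prod_(0 <= j < i) iter (j * k) phi (pos p)^-1)%g = ((pos (left_word i))^-1)%g.
Proof.
elim: i => [|i IH]; first by rewrite big_geq //= pos_nil invg1.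
by rewrite big_nat_recr //= IH iter_autV (induces_iter _ _ phi_g) pos_cat invMg.
Qed.

(** [right_word i] and [left_word i.+1] both have more than [i] letters, so [nth] does not reach its
    default value. *)
Definition attracting_right i : letter N := (nth a (right_word i) i, true).
Definition attracting_left i : letter N := (nth a (rev (left_word i.+1)) i, false).

Lemma attracting_rightP i : attracting_right i.+1 != inv_letter (attracting_right i).
Proof. by apply/eqP => -[]. Qed.

Lemma attracting_leftP i : attracting_left i.+1 != inv_letter (attracting_left i).
Proof. by apply/eqP => -[]. Qed.

Definition attracting_pair : boundary N * boundary N :=
  (Boundary attracting_leftP, Boundary attracting_rightP).

Lemma attracting_pair_positive : positive_pair attracting_pair.
Proof. by []. Qed.

Lemma attracting_pair_left i :
  coord attracting_pair (Negz i) = nth a (rev (left_word i.+1)) i.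
Proof. by []. Qed.

Lemma attracting_pair_right i :
  coord attracting_pair (Posz i) = nth a (right_word i) i.
Proof. by []. Qed.

Lemma attracting_pointP P :
  attracting_point phi a k (pos p) (pos s) P <-> P = attracting_pair.
Proof.
have wR : cvg_boundary (fun n => gen a * \prod_(0 <= i < n.+1) iter (i * k) phi (pos s))%g
    attracting_pair.2.
  move=> m; exists m => // i mi; have {}mi : m <= i := mi.
  rewrite prod_right.
  have ms := ltnW (leq_ltn_trans (leqW mi) (size_right_word i.+1)).
  apply: (@eq_from_nth _ (a, true)); rewrite size_take_min size_map ?size_mkseq.
    exact/minn_idPl.
  move=> j; rewrite (minn_idPl ms) => jm; rewrite nth_take // nth_mkseq //.
  rewrite (nth_map a) ?(leq_trans jm) //; congr pair; apply: nth_right_word.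
    exact: leq_trans jm ms.
  exact: size_right_word.
have wL : cvg_boundary (fun n => \prod_(0 <= i < n.+1) iter (i * k) phi (pos p)^-1)%g
    attracting_pair.1.
  move=> m; exists m => // i mi; have {}mi : m <= i := mi.
  rewrite prod_left word_posV -map_rev.
  have ms := leq_trans (leqW mi) (size_left_word i.+1).
  apply: (@eq_from_nth _ (a, false)); rewrite size_take_min size_map size_rev ?size_mkseq.
    exact/minn_idPl.
  move=> j; rewrite (minn_idPl ms) => jm; rewrite nth_take // nth_mkseq //.
  rewrite (nth_map a) ?size_rev ?(leq_trans jm) //; congr pair; apply: nth_left_word.
    exact: leq_trans jm ms.
  exact: size_left_word.
split=> [[PL PR]|-> //]; rewrite [P]surjective_pairing [RHS]surjective_pairing.
by congr pair; [exact: cvg_boundary_unique PL wL|exact: cvg_boundary_unique PR wR].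
Qed.

(** The cut of [left_right_word] sits at the origin of the attracting pair. *)
Lemma window_attracting_pair M :
  window attracting_pair (- (size (left_word M))%:Z)%R
    (size (iter (M * k) (subst g) [:: a])) = iter (M * k) (subst g) [:: a].
Proof.
rewrite left_right_word; apply: (@eq_from_nth _ a); rewrite size_mkseq // => i iM.
rewrite nth_mkseq // nth_cat; move: iM; rewrite size_cat => iM.
case: ltnP => il.
  have -> : (- (size (left_word M))%:Z + i%:Z)%R = Negz (size (left_word M) - i.+1).
    by move: (size _) il => l; lia.
  have jl : size (left_word M) - i.+1 < size (left_word M).
    by rewrite ltn_subrL /= (leq_ltn_trans _ il).
  rewrite attracting_pair_left (nth_left_word (j := M)) ?size_left_word // nth_rev //.
  by congr nth; move: (size _) il => l; lia.
have -> : (- (size (left_word M))%:Z + i%:Z)%R = Posz (i - size (left_word M)).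
  by move: (size _) il => l; lia.
rewrite attracting_pair_right; apply: nth_right_word (size_right_word _) _.
by rewrite ltn_subLR.
Qed.

Lemma attracting_subshiftP P :
  attracting_subshift phi a k (pos p) (pos s) P <->
  positive_pair P /\ forall m, factor_language g a k (central_window P m).
Proof.
have pA := attracting_pair_positive.
split=> [[_ /closure_cylinder cl]|[pP fP]].
  have {}cl m : exists i, let Q := shift2z i attracting_pair in
      cylinder P.1 m Q.1 /\ cylinder P.2 m Q.2.
    have [Q [[P' [i [/attracting_pointP -> ->]]] h1 h2]] := cl m.
    by exists i.
  have pP : positive_pair P.
    move=> m; have [i [h1 h2]] := cl m.+1; rewrite -h1 // -h2 //.
    exact: (shift2z_coord i pA).1.
  split=> // m; have [i /(window_cylinder _ pP (shift2z_coord i pA).1) <-] := cl m.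
  have -> : central_window (shift2z i attracting_pair) m =
      window attracting_pair (i - m%:Z)%R (m + m).
    apply: eq_map => j; rewrite (shift2z_coord i pA).2; congr coord; lia.
  (* Both halves have at least [M] letters, enough for a window of radius [m] centred at [i]. *)
  pose M := `|i|%N + m; exists M; rewrite -window_attracting_pair.
  set l := size (left_word M); have lM : M <= l := size_left_word M.
  have rM := size_right_word M.
  have -> : (i - m%:Z = - l%:Z + (absz (i - m%:Z + l%:Z))%:Z)%R by lia.
  apply: infix_window; rewrite left_right_word size_cat -/l.
  by move: (size (right_word M)) rM => r; lia.
split; first exact: positive_pair_neq.
apply/closure_cylinder => m; have [j] := fP m.
rewrite -window_attracting_pair => /infix_windowP[z].
(* The window starting at [z] becomes central after shifting by z + m. *)
rewrite size_mkseq => E; exists (shift2z (z + m%:Z)%R attracting_pair).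
have [pQ cQ] := shift2z_coord (z + m%:Z)%R pA.
have [|h1 h2] := (window_cylinder m pP pQ).1.
  rewrite E; apply: eq_map => i; rewrite cQ; congr coord; lia.
split=> //; exists attracting_pair, (z + m%:Z)%R; split=> //.
exact/attracting_pointP.
Qed.

End AttractingPoint.

(** * Existence of an attracting choice and equality of the subshifts *)

Section SelfInduced.
Variables (R : realType) (n : nat) (d : ciet R n) (m : nat) (e : R).
Hypothesis m_gt0 : 0 < m.
Hypothesis d_homothetic : homothetic e d (iter m (@rauzy_next R n) d).
Hypothesis d_inducible : forall i, i < m -> inducible (iter i (@rauzy_next R n) d).
Local Notation f := (rauzy_subst_iter m d).
Local Notation phi := (twists m d).

Lemma self_induced_attracting_choice : exists a k p s, attracting_choice phi a k p s.
Proof.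
have phif := twists_induces m d.
have [K K0 KP] := self_similar_primitive m_gt0 d_homothetic d_inducible.
(* Three letters: the image of the middle one contains [a], and the outer ones make both sides of it
   nonempty. *)
have [j jP] := size_iter_unbounded m_gt0 d_homothetic d_inducible 3.
pose a : 'I_n.+2 := ord0; have := jP a.
case E: (iter j (subst f) [:: a]) => [|b [|c [|b' w]]] // _.
have [q1 [q2 cE]] : exists q1 q2, iter K (subst f) [:: c] = q1 ++ a :: q2.
  by have /path.splitPr[q1 q2] := KP _ (leqnn K) c a; exists q1, q2.
have f0 : forall x, 0 < size (f x) by move=> x; exact: subst_nonempty.
exists a, (K + j), (pos (iter K (subst f) [:: b] ++ q1)),
  (pos (q2 ++ iter K (subst f) (b' :: w))).
split; [| |by rewrite addn_gt0 K0|].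
- by move=> x; rewrite phif positive_pos.
- by exists K => // x y; rewrite -pos1 (induces_iter _ _ phif) mem_pos; exact: KP.
split; rewrite ?positive_pos //.
- apply: pos_neq1; rewrite size_cat ltn_addr //.
  exact: leq_trans (size_iter_subst_ge _ _ f0).
- apply: pos_neq1; rewrite size_cat ltn_addl //.
  exact: leq_trans (size_iter_subst_ge _ _ f0).
- rewrite -pos1 (induces_iter _ _ phif) iterD E -!pos_cat; congr pos.
  by rewrite -cat1s iter_subst_cat -(cat1s c) iter_subst_cat cE -!catA.
Qed.

Lemma self_induced_subshift a k p s : attracting_choice phi a k p s ->
  ciet_subshift d = attracting_subshift phi a k p s.
Proof.
have phif := twists_induces m d.
have f0 : forall x, 0 < size (f x) by move=> x; exact: subst_nonempty.
case=> _ _ k0 [p1 s1 pp sp].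
have pE := positive_wordE pp; have sE := positive_wordE sp.
move: (map fst p) (map fst s) pE sE => u v pE sE; subst p s.
have u0 : 0 < size u by case: u p1 {pp} => //; rewrite pos_nil.
have v0 : 0 < size v by case: v s1 {sp} => //; rewrite pos_nil.
rewrite -pos1 (induces_iter _ _ phif) -!pos_cat -catA => /pos_inj kE.
apply/seteqP; split=> P.
  move/ciet_subshiftP=> [pP tP]; apply/(attracting_subshiftP phif f0 u0 v0 kE).
  by split=> // i; apply/(admissible_factor m_gt0 d_homothetic d_inducible).
move/(attracting_subshiftP phif f0 u0 v0 kE)=> [pP fP]; apply/ciet_subshiftP.
split=> // i; exact/(admissible_factor m_gt0 d_homothetic d_inducible _ _ k0).
Qed.

End SelfInduced.

Theorem theorem2p8 (R : realType) (n : nat) (d : ciet R n)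
    (phi : automorphism n.+2)
    (d_self_induced : self_induced d)
    (phi_delta : delta_automorphism d phi) :
  (exists a k p s, attracting_choice phi a k p s) /\
  (forall a k p s, attracting_choice phi a k p s ->
     ciet_subshift d = attracting_subshift phi a k p s).
Proof.
have [m [m0 [d' [dd' p0 p1 [e e0 dl]]] _ phiE]] := phi_delta.
have [d'E dI] := rauzy_iter_next dd'.
have dh : homothetic e d (iter m (@rauzy_next R n) d) by rewrite d'E.
rewrite phiE; split; first exact: self_induced_attracting_choice m0 dh dI.
by move=> a k p s; exact: self_induced_subshift m0 dh dI a k p s.
Qed.
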